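(* Let $\mathcal{B}\subseteq\mathcal{A}$ be a $C^*$-irreducible inclusion of $C^*$-algebras and let $\mathcal{E}$ be a unital simple $C^*$-algebra with Wassermann's property (S). Then $\mathcal{E}\otimes\mathcal{B}\subseteq\mathcal{E}\otimes\mathcal{A}$ is $C^*$-irreducible.
   Context: $\otimes$ denotes the minimal $C^*$-tensor product. A unital inclusion $\mathcal{B}\subseteq\mathcal{A}$ of $C^*$-algebras (the unit of $\mathcal{A}$ belongs to $\mathcal{B}$) is $C^*$-irreducible if each intermediate $C^*$-algebra $\mathcal{B}\subseteq\mathcal{D}\subseteq\mathcal{A}$ (including $\mathcal{B}$ and $\mathcal{A}$) is simple. For unital $C^*$-algebras $\mathcal{E}$, $\mathcal{C}$ and $\varphi\in\mathcal{E}^*$, the slice map $R_\varphi\colon\mathcal{E}\otimes\mathcal{C}\to\mathcal{C}$ is the bounded linear map with $R_\varphi(e\otimes c)=\varphi(e)c$. $\mathcal{E}$ has Wassermann's property (S) if for each unital inclusion $\mathcal{C}_0\subseteq\mathcal{C}$ of $C^*$-algebras and each $x\in\mathcal{E}\otimes\mathcal{C}$, one has $x\in\mathcal{E}\otimes\mathcal{C}_0$ if and only if $R_\varphi(x)\in\mathcal{C}_0$ for all $\varphi\in\mathcal{E}^*$. *)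

(* Defs.v *)
From HB Require Import structures.
From mathcomp Require Import all_boot all_order all_algebra.
From mathcomp Require Import all_classical all_reals all_analysis.
From mathcomp Require Import complex.

Set Implicit Arguments.
Unset Strict Implicit.
Unset Printing Implicit Defensive.

Import Order.TTheory GRing.Theory Num.Theory.
Import numFieldNormedType.Exports.

Local Open Scope classical_set_scope.
Local Open Scope ring_scope.
Local Open Scope complex_scope.

(** Norms of complex normed spaces take values in [R[i]], with the partial
    order [x <= y] iff [y - x] is a nonnegative real. *)

(** The library has no common substructure of rings and normed modules other
    than the numeric domains, so the product is a field here; the [algType]
    structure it defines, hence the notations [*] and [1], is declared on
    [CStarAlgebra.sort] below. *)
HB.mixin Record isCStarAlgebra (R : realType) A
    & CompleteNormedModule R[i] A := {
  cone : A;
  cmul : A -> A -> A;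
  cmulA : associative cmul;
  cmul1x : left_id cone cmul;
  cmulx1 : right_id cone cmul;
  cmulDl : left_distributive cmul +%R;
  cmulDr : right_distributive cmul +%R;
  cone_neq0 : cone != 0;
  cmulZl : forall (a : R[i]) x y, a *: cmul x y = cmul (a *: x) y;
  cmulZr : forall (a : R[i]) x y, a *: cmul x y = cmul x (a *: y);
  cmul_norm : forall x y : A, `|cmul x y| <= `|x| * `|y|;
  star : A -> A;
  starD : forall x y, star (x + y) = star x + star y;
  starZ : forall (a : R[i]) x, star (a *: x) = Num.conj a *: star x;
  starM : forall x y, star (cmul x y) = cmul (star y) (star x);
  starK : involutive star;
  cstar_norm : forall x : A, `|cmul (star x) x| = `|x| ^+ 2
}.

(** Nonzero unital C*-algebras. *)
#[short(type="cstarAlgType")]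
HB.structure Definition CStarAlgebra (R : realType) :=
  {A of isCStarAlgebra R A & CompleteNormedModule R[i] A}.

HB.instance Definition _ (R : realType) (A : cstarAlgType R) :=
  GRing.Zmodule_isNzRing.Build (CStarAlgebra.sort A)
    cmulA cmul1x cmulx1 cmulDl cmulDr cone_neq0.
HB.instance Definition _ (R : realType) (A : cstarAlgType R) :=
  GRing.Lmodule_isLalgebra.Build R[i] (CStarAlgebra.sort A) cmulZl.
#[non_forgetful_inheritance]
HB.instance Definition _ (R : realType) (A : cstarAlgType R) :=
  GRing.Lalgebra_isAlgebra.Build R[i] (CStarAlgebra.sort A) cmulZr.

HB.mixin Record hasInnerProduct (R : realType) H
    & CompleteNormedModule R[i] H := {
  inner : {dot H for (@Num.conj R[i])};
  inner_norm : forall x : H, `|x| ^+ 2 = inner x x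
}.

(** Complex Hilbert spaces; the inner product is linear in its first
    argument. *)
#[short(type="hilbertType")]
HB.structure Definition Hilbert (R : realType) :=
  {H of hasInnerProduct R H & CompleteNormedModule R[i] H}.

Section CStarInclusions.
Variables (R : realType) (A : cstarAlgType R).
Implicit Types B D I : set A.

(** Norm-closed *-subalgebras containing the unit of [A]. *)
Definition cstar_subalgebra B :=
  [/\ B 1,
      (forall x y, B x -> B y -> B (x + y)),
      (forall (a : R[i]) x, B x -> B (a *: x)),
      (forall x y, B x -> B y -> B (x * y)) &
      (forall x, B x -> B (star x)) /\ closed B].

Definition closed_ideal D I :=
  [/\ I `<=` D, I 0,
      (forall x y, I x -> I y -> I (x + y)),
      (forall (a : R[i]) x, I x -> I (a *: x)) &
      (forall d x, D d -> I x -> I (d * x) /\ I (x * d)) /\ closed I].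

(** Simplicity of the C*-algebra [D], for a C*-subalgebra [D] of [A]. *)
Definition cstar_simple D :=
  forall I, closed_ideal D I -> I = [set 0] \/ I = D.

Definition cstar_irreducible B :=
  cstar_subalgebra B /\
  forall D, cstar_subalgebra D -> B `<=` D -> cstar_simple D.

End CStarInclusions.

(** Unital *-representations of [A] on [H]. *)
Record representation (R : realType) (A : cstarAlgType R) (H : hilbertType R) :=
  Representation {
  rep :> A -> {linear H -> H};
  rep_continuous : forall a, continuous (rep a);
  rep1 : forall h, rep 1 h = h;
  repD : forall a b h, rep (a + b) h = rep a h + rep b h;
  repZ : forall (l : R[i]) a h, rep (l *: a) h = l *: rep a h;
  repM : forall a b h, rep (a * b) h = rep a (rep b h);
  rep_star : forall a h k, inner (rep (star a) h) k = inner h (rep a k)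
}.

Section SpatialNorm.
Variable R : realType.

(** A list [s] of pairs stands for the sum of the elementary tensors
    [p.1 (x) p.2], [p] in [s]. [hnorm s] is its norm in the Hilbert space
    tensor product of [H] and [K], computed from
    [<h (x) k, h' (x) k'> = <h, h'> <k, k'>]. *)
Definition hnorm (H K : hilbertType R) (s : seq (H * K)) : R[i] :=
  sqrtC (\sum_(p <- s) \sum_(q <- s) inner p.1 q.1 * inner p.2 q.2).

(** The image of [s] under [(pi (x) rho) u]. *)
Definition rep_tensor (E C : cstarAlgType R) (H K : hilbertType R)
    (pi : representation E H) (rho : representation C K)
    (u : seq (E * C)) (s : seq (H * K)) : seq (H * K) :=
  [seq (pi p.1 q.1, rho p.2 q.2) | p <- u, q <- s].

(** The values [||(pi (x) rho)(u) s||] over all pairs of representations and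
    all [s] in the unit ball of the algebraic tensor product, which is dense
    in the unit ball of its completion. *)
Definition spatial_values (E C : cstarAlgType R) (u : seq (E * C)) :
    set R[i] :=
  [set r | exists (H K : hilbertType R) (pi : representation E H)
             (rho : representation C K) (s : seq (H * K)),
     hnorm s <= 1 /\ r = hnorm (rep_tensor pi rho u s)].

End SpatialNorm.

(** The minimal C*-tensor product of [E] and [C], which is determined up to
    isomorphism: a C*-algebra containing the algebraic tensor product as a
    dense *-subalgebra, with the minimal (spatial) norm
    [||u||_min = sup ||(pi (x) rho)(u)||]. *)
Record minTensor (R : realType) (E C : cstarAlgType R) := MinTensor {
  tensor_alg :> cstarAlgType R;
  tens : E -> C -> tensor_alg;
  tensDl : forall e e' c, tens (e + e') c = tens e c + tens e' c;
  tensDr : forall e c c', tens e (c + c') = tens e c + tens e c';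
  tensZl : forall (a : R[i]) e c, tens (a *: e) c = a *: tens e c;
  tensZr : forall (a : R[i]) e c, tens e (a *: c) = a *: tens e c;
  tens1 : tens 1 1 = 1;
  tensM : forall e e' c c', tens e c * tens e' c' = tens (e * e') (c * c');
  tens_star : forall e c, star (tens e c) = tens (star e) (star c);
  tens_norm : forall u : seq (E * C),
    supremums (spatial_values u) `|\sum_(p <- u) tens p.1 p.2|;
  tens_dense : dense [set x | exists u : seq (E * C),
    x = \sum_(p <- u) tens p.1 p.2]
}.

Section Slices.
Variables (R : realType) (E C : cstarAlgType R) (T : minTensor E C).

(** [E (x) C0] as a subset of [E (x) C]. *)
Definition tensor_sub (C0 : set C) : set T :=
  closure [set x | exists2 u : seq (E * C), (forall p, p \in u -> C0 p.2) &
    x = \sum_(p <- u) tens T p.1 p.2].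

Definition is_slice_map (phi : E -> R[i]) (S : T -> C) :=
  [/\ linear S, continuous S & forall e c, S (tens T e c) = phi e *: c].

End Slices.

Definition propertyS (R : realType) (E : cstarAlgType R) :=
  forall (C : cstarAlgType R) (C0 : set C) (T : minTensor E C) (x : T),
    cstar_subalgebra C0 ->
    (tensor_sub C0 x <->
     forall (phi : {linear E -> R[i]^o}) (S : T -> C),
       continuous phi -> is_slice_map phi S -> C0 (S x)).

(* Main.v *)
(** Let [I] be a nonzero closed ideal of an intermediate algebra [D] and let
    [x] be a nonzero element of [I]. It suffices to find [c <> 0] in [A] with
    [1 (x) c] in [I]: the set of all [c] with [1 (x) c] in [I] is then a nonzero
    closed ideal of [{a | 1 (x) a \in D}], which lies between [B] and [A] and
    hence is simple, so [1] belongs to [I].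

    The element [c] comes from a slice of [x] by a state of [E] that is excised
    approximately. Bisecting the spectrum of compressions produces
    [a_n = b_0 ... b_n] in [E] such that [a_n^* e a_n] is close to a multiple of
    [a_n^* a_n] for every [e] in a prescribed finite set, and this persists when
    [a_n] is multiplied on the right. As [E] is simple,
    [\sum_i y_i^* a_n^* a_n y_i = 1] for some [y_i], and the maps
    [z |-> \sum_i (a_n y_i)^* z (a_n y_i)], which preserve [I], send [x] closer
    and closer to [1 (x) A]. The spatial norm provides a vector functional [psi]
    of [A] for which the slice of [x] by [psi] is nonzero in [E]; taking [b_0]
    at the top of the spectrum of that slice makes the limit nonzero. *)

Require Import Defs.
From mathcomp Require Import all_boot all_order all_algebra.
From mathcomp Require Import all_classical all_reals all_analysis.
From mathcomp Require Import complex.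
From mathcomp Require Import ring lra.

Set Implicit Arguments.
Unset Strict Implicit.
Unset Printing Implicit Defensive.
Import Order.TTheory GRing.Theory Num.Theory.
Import numFieldNormedType.Exports.
Local Open Scope classical_set_scope.
Local Open Scope ring_scope.
Local Open Scope complex_scope.

(** * Noncommutative polynomial identities *)

Section NoncommutativeIdentities.
Variables (C : comNzRingType) (A : algType C).

Inductive nc_expr :=
  | NcVar of nat | NcZero | NcOne | NcAdd of nc_expr & nc_expr
  | NcOpp of nc_expr | NcMul of nc_expr & nc_expr | NcScale of C & nc_expr.

Fixpoint nc_eval (e : list A) (x : nc_expr) : A :=
  match x with
  | NcVar i => List.nth i e 0
  | NcZero => 0
  | NcOne => 1
  | NcAdd x y => nc_eval e x + nc_eval e y
  | NcOpp x => - nc_eval e x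
  | NcMul x y => nc_eval e x * nc_eval e y
  | NcScale c x => c *: nc_eval e x
  end.

Fixpoint nc_mono (e : list A) (m : list nat) : A :=
  match m with
  | nil => 1
  | cons i m => List.nth i e 0 * nc_mono e m
  end.

Fixpoint nc_poly (e : list A) (p : list (C * list nat)) : A :=
  match p with
  | nil => 0
  | cons (c, m) p => c *: nc_mono e m + nc_poly e p
  end.

(** Dedicated functions on numbers and lists, so that [cbv] restricted to the [nc_] names computes
    the normal form and leaves the coefficients in [C] folded. *)
Fixpoint nc_nat_eq (i j : nat) : bool :=
  match i, j with
  | O, O => true
  | S i, S j => nc_nat_eq i j
  | _, _ => false
  end.

Fixpoint nc_mono_eq (m n : list nat) : bool :=
  match m, n with
  | nil, nil => true
  | cons i m, cons j n => if nc_nat_eq i j then nc_mono_eq m n else false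
  | _, _ => false
  end.

Fixpoint nc_insert (c : C) (m : list nat) (p : list (C * list nat)) :=
  match p with
  | nil => cons (c, m) nil
  | cons (d, n) q =>
    if nc_mono_eq m n then cons (c + d, n) q else cons (d, n) (nc_insert c m q)
  end.

Fixpoint nc_mono_cat (m n : list nat) : list nat :=
  match m with nil => n | cons i m => cons i (nc_mono_cat m n) end.

Fixpoint nc_add (p q : list (C * list nat)) :=
  match p with nil => q | cons (c, m) p => nc_insert c m (nc_add p q) end.

Fixpoint nc_term_mul (c : C) (m : list nat) (q : list (C * list nat)) :=
  match q with
  | nil => nil
  | cons (d, n) q => nc_insert (c * d) (nc_mono_cat m n) (nc_term_mul c m q)
  end.

Fixpoint nc_mul (p q : list (C * list nat)) :=
  match p with
  | nil => nil
  | cons (c, m) p => nc_add (nc_term_mul c m q) (nc_mul p q)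
  end.

Fixpoint nc_norm (x : nc_expr) : list (C * list nat) :=
  match x with
  | NcVar i => cons (1, cons i nil) nil
  | NcZero => nil
  | NcOne => cons (1, nil) nil
  | NcAdd x y => nc_add (nc_norm x) (nc_norm y)
  | NcOpp x => nc_term_mul (-1) nil (nc_norm x)
  | NcMul x y => nc_mul (nc_norm x) (nc_norm y)
  | NcScale c x => nc_term_mul c nil (nc_norm x)
  end.

(** Vanishing of coefficients is not decided by computation; each becomes an equation in [C], to be
    settled by [ring] or [field]. *)
Fixpoint nc_null (p : list (C * list nat)) : Prop :=
  match p with
  | nil => True
  | cons (c, _) p => c = 0 /\ nc_null p
  end.

Lemma nc_mono_eqP m n : nc_mono_eq m n -> m = n.
Proof.
have nat_eqP i j : nc_nat_eq i j -> i = j.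
  by elim: i j => [|i IH] [|j] //= /IH ->.
elim: m n => [|i m IH] [|j n] //=.
by case E: (nc_nat_eq i j) => // /IH ->; rewrite (nat_eqP _ _ E).
Qed.

Lemma nc_insertE e c m p :
  nc_poly e (nc_insert c m p) = c *: nc_mono e m + nc_poly e p.
Proof.
elim: p => [|[d n] q IH] //=.
case E: (nc_mono_eq m n) => /=; last by rewrite IH addrCA.
by rewrite (nc_mono_eqP E) scalerDl addrA.
Qed.

Lemma nc_mono_catE e m n :
  nc_mono e (nc_mono_cat m n) = nc_mono e m * nc_mono e n.
Proof. by elim: m => [|i m IH] /=; rewrite ?mul1r // IH mulrA. Qed.

Lemma nc_addE e p q : nc_poly e (nc_add p q) = nc_poly e p + nc_poly e q.
Proof.
by elim: p => [|[c m] p IH] /=; rewrite ?add0r // nc_insertE IH addrA.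
Qed.

Lemma nc_term_mulE e c m q :
  nc_poly e (nc_term_mul c m q) = (c *: nc_mono e m) * nc_poly e q.
Proof.
elim: q => [|[d n] q IH] /=; first by rewrite mulr0.
rewrite nc_insertE IH nc_mono_catE mulrDr; congr (_ + _).
by rewrite -scalerAl -scalerAr scalerA.
Qed.

Lemma nc_mulE e p q : nc_poly e (nc_mul p q) = nc_poly e p * nc_poly e q.
Proof.
elim: p => [|[c m] p IH] /=; first by rewrite mul0r.
by rewrite nc_addE nc_term_mulE IH mulrDl.
Qed.

Lemma nc_normE e x : nc_poly e (nc_norm x) = nc_eval e x.
Proof.
elim: x => [i|||x IHx y IHy|x IHx|x IHx y IHy|c x IHx] //=.
- by rewrite mulr1 scale1r addr0.
- by rewrite scale1r addr0.
- by rewrite nc_addE IHx IHy.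
- by rewrite nc_term_mulE IHx /= scaleN1r mulN1r.
- by rewrite nc_mulE IHx IHy.
- by rewrite nc_term_mulE IHx /= -scalerAl mul1r.
Qed.

Lemma nc_sound e x y :
  nc_null (nc_norm (NcAdd x (NcOpp y))) -> nc_eval e x = nc_eval e y.
Proof.
move=> h; apply/eqP; rewrite -subr_eq0.
rewrite -[_ - _]/(nc_eval e (NcAdd x (NcOpp y))) -nc_normE.
elim: (nc_norm _) h => [|[c m] p IH] //= [-> /IH/eqP ->].
by rewrite scale0r addr0.
Qed.

End NoncommutativeIdentities.

Ltac nc_mem a l :=
  lazymatch l with
  | nil => constr:(false)
  | cons a _ => constr:(true)
  | cons _ ?l => nc_mem a l
  end.
Ltac nc_atom a l :=
  lazymatch nc_mem a l with true => l | false => constr:(cons a l) end.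
Ltac nc_index a l :=
  lazymatch l with
  | cons a _ => constr:(O)
  | cons _ ?l => let i := nc_index a l in constr:(S i)
  end.
Ltac nc_atoms x l :=
  lazymatch x with
  | @GRing.add _ ?x ?y => let l := nc_atoms x l in nc_atoms y l
  | @GRing.mul _ ?x ?y => let l := nc_atoms x l in nc_atoms y l
  | @GRing.opp _ ?x => nc_atoms x l
  | @GRing.scale _ _ _ ?x => nc_atoms x l
  | @GRing.natmul _ ?x _ => nc_atoms x l
  | @GRing.zero _ => l
  | @GRing.one _ => l
  | _ => nc_atom x l
  end.
Ltac nc_reify C x l :=
  lazymatch x with
  | @GRing.add _ ?x ?y =>
    let x := nc_reify C x l in let y := nc_reify C y l in constr:(@NcAdd C x y)
  | @GRing.mul _ ?x ?y =>
    let x := nc_reify C x l in let y := nc_reify C y l in constr:(@NcMul C x y)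
  | @GRing.opp _ ?x => let x := nc_reify C x l in constr:(@NcOpp C x)
  | @GRing.scale _ _ ?c ?x =>
    let x := nc_reify C x l in constr:(@NcScale C c x)
  | @GRing.zero _ => constr:(@NcZero C)
  | @GRing.one _ => constr:(@NcOne C)
  | _ => let i := nc_index x l in constr:(@NcVar C i)
  end.
Ltac nc_ring C :=
  lazymatch goal with |- @eq ?T ?x ?y =>
    let l := nc_atoms x (@nil T) in
    let l := nc_atoms y l in
    let x := nc_reify C x l in
    let y := nc_reify C y l in
    refine (@nc_sound C _ l x y _);
    cbv [nc_null nc_norm nc_add nc_mul nc_term_mul nc_insert nc_mono_cat
         nc_mono_eq nc_nat_eq];
    repeat split
  end.
(** Reduces an identity between noncommutative polynomials with complex
    coefficients to the vanishing of the coefficients of the difference, and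
    leaves those that [ring] does not settle. *)
Ltac nc :=
  lazymatch goal with
  | _ : cstarAlgType ?R |- _ => nc_ring (complex R)
  end; try ring.

(** * Real-valued norms *)

Section RealNorm.
Variable R : realType.

(** Moves norms from the partially ordered [R[i]] to the totally ordered [R], where [lra] and [nra]
    apply. *)
Definition nr (V : normedModType R[i]) (x : V) : R := complex.Re `|x|.

Section Modules.
Variable V : normedModType R[i].
Implicit Types x y : V.

Lemma nrE x : `|x| = (nr x)%:C.
Proof. by rewrite /nr RRe_real ?normr_real. Qed.

Lemma nr_ge0 x : 0 <= nr x.
Proof. by rewrite -lecR -nrE rmorph0 normr_ge0. Qed.

Lemma nr0 : nr (0 : V) = 0.
Proof. by rewrite /nr normr0. Qed.

Lemma nr0_eq0 x : nr x = 0 -> x = 0.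
Proof. by move=> h; apply: normr0_eq0; rewrite nrE h rmorph0. Qed.

Lemma nr_le0 x : nr x <= 0 -> x = 0.
Proof. by move=> h; apply: nr0_eq0; apply/eqP; rewrite eq_le h nr_ge0. Qed.

Lemma nr_gt0 x : x != 0 -> 0 < nr x.
Proof.
move=> x0; rewrite lt_neqAle nr_ge0 andbT eq_sym.
by apply: contra_neq x0 => /nr0_eq0.
Qed.

Lemma nrN x : nr (- x) = nr x.
Proof. by rewrite /nr normrN. Qed.

Lemma nrC x y : nr (x - y) = nr (y - x).
Proof. by rewrite -nrN opprB. Qed.

Lemma nrD x y : nr (x + y) <= nr x + nr y.
Proof. by rewrite -lecR rmorphD /= -!nrE ler_normD. Qed.

Lemma nrB x y : nr (x - y) <= nr x + nr y.
Proof. by rewrite -(nrN y) nrD. Qed.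

Lemma nr_dist x y z : nr (x - z) <= nr (x - y) + nr (y - z).
Proof.
have -> : x - z = (x - y) + (y - z) by rewrite addrA subrK.
exact: nrD.
Qed.

Lemma nr_leB x y : nr x <= nr y + nr (x - y).
Proof. by rewrite -{1}(subrK y x) addrC nrD. Qed.

Lemma nrZ (c : R[i]) x : nr (c *: x) = complex.Re `|c| * nr x.
Proof.
have /RRe_real hc : `|c| \is Num.real by rewrite normr_real.
by apply: (@complexI R); rewrite rmorphM [RHS]/= -!nrE normrZ -[in LHS]hc.
Qed.

Lemma normCR (r : R) : `|r%:C| = `|r|%:C.
Proof. by rewrite normc_def /= expr0n /= addr0 sqrtr_sqr. Qed.

Lemma nrZr (r : R) x : nr (r%:C *: x) = `|r| * nr x.
Proof. by rewrite nrZ normCR. Qed.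

Lemma nr_sum (I : Type) (s : seq I) (F : I -> V) :
  nr (\sum_(i <- s) F i) <= \sum_(i <- s) nr (F i).
Proof.
elim: s => [|i s IH]; first by rewrite !big_nil nr0.
by rewrite !big_cons (le_trans (nrD _ _)) // lerD2l.
Qed.

Lemma ballR x (e : R) y : ball x e%:C y = (nr (x - y) < e).
Proof. by rewrite -ball_normE /ball_ /= nrE ltcR. Qed.

Lemma gt0CR (e : R[i]) : 0 < e -> exists2 r : R, 0 < r & e = r%:C.
Proof.
move=> e0; exists (complex.Re e); last by rewrite RRe_real // gtr0_real.
by move: e0; rewrite ltcE /= => /andP[].
Qed.

Lemma nbhsR x (U : set V) :
  nbhs x U <-> exists2 e : R, 0 < e & forall y, nr (x - y) < e -> U y.
Proof.
split.
  move=> /nbhs_ballP[e /= /gt0CR[r r0 ->] h]; exists r => // y hy.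
  by apply: h; rewrite ballR.
move=> [e e0 h]; apply/nbhs_ballP; exists e%:C; first by rewrite /= ltcR.
by move=> y; rewrite ballR; exact: h.
Qed.

Lemma closureR (B : set V) x :
  closure B x <-> forall e : R, 0 < e -> exists2 b, B b & nr (x - b) < e.
Proof.
split=> [h e e0|h U /nbhsR[e e0 hU]].
  have /h[y [By hy]] : nbhs x [set y | nr (x - y) < e].
    by apply/nbhsR; exists e.
  by exists y.
by have [b Bb xb] := h e e0; exists b; split => //; apply: hU.
Qed.

Lemma closedR (B : set V) :
  closed B <->
  forall x, (forall e : R, 0 < e -> exists2 b, B b & nr (x - b) < e) -> B x.
Proof.
by split=> h x => [/closureR/h|hx]; [|apply: h; apply/closureR].
Qed.

End Modules.

(** Serves to extend stability under sums, products and adjoints from a set to its norm closure. *)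
Lemma closure_lipschitz (V W : normedModType R[i]) (f : V -> W) (C : R)
    (S : set V) (S' : set W) (x : V) :
  0 <= C -> (forall y z, nr (f y - f z) <= C * nr (y - z)) ->
  (forall y, S y -> closure S' (f y)) -> closure S x -> closure S' (f x).
Proof.
move=> C0 fC fS /closureR xS; apply/closureR => e e0.
have e1 : 0 < e / 2 / (C + 1) by rewrite !divr_gt0 // ltr_wpDl.
have e2 : 0 < e / 2 by lra.
have [y /fS/closureR/(_ _ e2)[z Sz yz] xy] := xS _ e1; exists z => //.
apply: le_lt_trans (nr_dist _ (f y) _) _; have := fC x y.
move: xy; rewrite ltr_pdivlMr ?ltr_wpDl //; have := nr_ge0 (x - y); nra.
Qed.

Lemma nr_complete (V : completeNormedModType R[i]) (u : nat -> V) :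
  (forall e : R, 0 < e -> exists N, forall m n, (N <= m)%N -> (N <= n)%N ->
     nr (u m - u n) <= e) ->
  exists l, forall e : R, 0 < e -> exists N, forall n, (N <= n)%N ->
     nr (l - u n) <= e.
Proof.
move=> h.
have /cauchy_cvg : cauchy (u @ \oo).
  apply: cauchy_exP => e /gt0CR[r r0 ->].
  have r2 : 0 < r / 2 by lra.
  have [N hN] := h _ r2; exists (u N).
  exists N => // n /= Nn; rewrite ballR.
  by apply: le_lt_trans (hN _ _ (leqnn N) Nn) _; lra.
move=> /cvg_ex[l hl]; exists l => e e0.
have /hl[N _ hN] : nbhs l [set y | nr (l - y) < e] by apply/nbhsR; exists e.
by exists N => n Nn; apply/ltW/(hN n).
Qed.

(** The bounded sequence [sg] is nondecreasing and approaches its supremum, hence is Cauchy; its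
    increments dominate those of [u]. *)
Lemma nr_summable (V : completeNormedModType R[i]) (u : nat -> V)
    (sg : nat -> R) (b : R) :
  (forall n, nr (u n.+1 - u n) <= sg n.+1 - sg n) -> (forall n, sg n <= b) ->
  exists l, forall e : R, 0 < e -> exists N, forall n, (N <= n)%N ->
     nr (l - u n) <= e.
Proof.
move=> hu hb; apply: nr_complete => e e0.
have nd : {homo sg : n m / (n <= m)%N >-> n <= m}.
  apply: homo_leq => // [x y z /le_trans|n]; first exact.
  by have := le_trans (nr_ge0 _) (hu n); rewrite subr_ge0.
have hm n k : nr (u (n + k)%N - u n) <= sg (n + k)%N - sg n.
  elim: k => [|k IH]; first by rewrite addn0 !subrr nr0.
  rewrite addnS (le_trans (nr_dist _ (u (n + k)%N) _)) //.
  by have := hu (n + k)%N; lra.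
have hs : has_sup (range sg).
  by split; [exists (sg 0%N), 0%N | exists b => _ [n _ <-]].
have e2 : 0 < e / 2 by lra.
have [_ [N _ <-] hN] := sup_adherent e2 hs.
have hle n : (N <= n)%N -> nr (u n - u N) <= e / 2.
  move=> /subnKC <-; apply: le_trans (hm _ _) _.
  have : sg (N + (n - N))%N <= sup (range sg).
    by apply: ub_le_sup; [case: hs | exists (N + (n - N))%N].
  by lra.
exists N => m n /hle hm' /hle hn'.
by rewrite (le_trans (nr_dist _ (u N) _)) // (nrC (u N)); lra.
Qed.

End RealNorm.

(** * Square roots in C*-algebras *)

Section CStar.
Variables (R : realType) (A : cstarAlgType R).
Implicit Types a b p q u v x y z : A.

Lemma nrM x y : nr (x * y) <= nr x * nr y.
Proof. by rewrite -lecR rmorphM /= -!nrE; exact: cmul_norm. Qed.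

Lemma star0 : star (0 : A) = 0.
Proof. by apply: (addIr (star (0 : A))); rewrite -starD !add0r. Qed.

Lemma starN x : star (- x) = - star x.
Proof. by apply: (addIr (star x)); rewrite -starD !addNr star0. Qed.

Lemma starB x y : star (x - y) = star x - star y.
Proof. by rewrite starD starN. Qed.

Lemma star_mul x y : star (x * y) = star y * star x.
Proof. exact: starM. Qed.

Lemma star1 : star (1 : A) = 1.
Proof. by rewrite -[LHS]mulr1 -[X in _ * X]starK -star_mul mulr1 starK. Qed.

Lemma starZr (r : R) x : star (r%:C *: x) = r%:C *: star x.
Proof.
by rewrite starZ; congr (_ *: _); apply/CrealP; rewrite complex_real.
Qed.

Lemma starZi x : star ('i *: x) = - ('i *: star x).
Proof. by rewrite starZ conjCi scaleNr. Qed.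

Lemma star_sum (I : Type) (s : seq I) (F : I -> A) :
  star (\sum_(i <- s) F i) = \sum_(i <- s) star (F i).
Proof.
by elim: s => [|i s IH]; rewrite ?big_nil ?star0 // !big_cons starD IH.
Qed.

Lemma nr_cstar x : nr (star x * x) = nr x ^+ 2.
Proof.
apply: (@complexI R); rewrite rmorphXn /= -!nrE; exact: cstar_norm.
Qed.

Lemma nr_star x : nr (star x) = nr x.
Proof.
have h y : nr y <= nr (star y).
  have [->|/nr_gt0 y0] := eqVneq y 0; first by rewrite nr0 nr_ge0.
  by rewrite -(ler_pM2r y0) -expr2 -nr_cstar nrM.
by apply/eqP; rewrite eq_le h -{2}(starK x) h.
Qed.

Lemma nr1 : nr (1 : A) = 1.
Proof.
have /nr_gt0 h : (1 : A) != 0 by exact: oner_neq0.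
have := nr_cstar 1; rewrite star1 mulr1 expr2 => e.
by apply: (mulfI (lt0r_neq0 h)); rewrite mulr1 -e.
Qed.

Lemma nr_scalar (r : R) : nr (r%:C *: (1 : A)) = `|r|.
Proof. by rewrite nrZr nr1 mulr1. Qed.

Lemma closure_add (S : set A) x y : (forall x y, S x -> S y -> S (x + y)) ->
  closure S x -> closure S y -> closure S (x + y).
Proof.
move=> SD Sx; apply: (@closure_lipschitz _ _ _ _ 1) => // [z t|z Sz].
  by rewrite opprD addrACA subrr add0r mul1r.
apply: (@closure_lipschitz _ _ _ (+%R^~ z) 1 S) => // [t t'|t St].
  by rewrite opprD addrACA subrr addr0 mul1r.
exact/subset_closure/SD.
Qed.

Lemma closure_scale (S : set A) (c : R[i]) x : (forall x, S x -> S (c *: x)) ->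
  closure S x -> closure S (c *: x).
Proof.
move=> SZ; apply: (@closure_lipschitz _ _ _ _ (complex.Re `|c|)) => [|z t|z Sz].
- exact: (nr_ge0 (c : R[i]^o)).
- by rewrite -scalerBr nrZ.
- exact/subset_closure/SZ.
Qed.

Lemma closure_mull (S S' : set A) d x : (forall x, S x -> closure S' (d * x)) ->
  closure S x -> closure S' (d * x).
Proof.
move=> SM; apply: (@closure_lipschitz _ _ _ _ (nr d)) => // [|z t].
  exact: nr_ge0.
by rewrite -mulrBr nrM.
Qed.

Lemma closure_mulr (S S' : set A) d x : (forall x, S x -> closure S' (x * d)) ->
  closure S x -> closure S' (x * d).
Proof.
move=> SM.
apply: (@closure_lipschitz _ _ _ (fun x => x * d) (nr d)) => // [|z t].
  exact: nr_ge0.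
by rewrite -mulrBl mulrC nrM.
Qed.

Lemma closure_mul (S : set A) x y : (forall x y, S x -> S y -> S (x * y)) ->
  closure S x -> closure S y -> closure S (x * y).
Proof.
move=> SM Sx; apply: closure_mull => z Sz; apply: closure_mulr Sx => t St.
exact/subset_closure/SM.
Qed.

Lemma closure_star (S : set A) x : (forall x, S x -> S (star x)) ->
  closure S x -> closure S (star x).
Proof.
move=> Ss; apply: (@closure_lipschitz _ _ _ _ 1) => // [z t|z Sz].
  by rewrite -starB nr_star mul1r.
exact/subset_closure/Ss.
Qed.

Definition sa x := star x = x.

Lemma sa_sq x : sa x -> nr (x * x) = nr x ^+ 2.
Proof. by move=> h; rewrite -nr_cstar h. Qed.

Lemma sa0 : sa 0. Proof. exact: star0. Qed.

Lemma sa1 : sa 1. Proof. exact: star1. Qed.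

Lemma saD x y : sa x -> sa y -> sa (x + y).
Proof. by rewrite /sa starD => -> ->. Qed.

Lemma saN x : sa x -> sa (- x).
Proof. by rewrite /sa starN => ->. Qed.

Lemma saB x y : sa x -> sa y -> sa (x - y).
Proof. by move=> hx hy; apply/saD/saN. Qed.

Lemma saZ (r : R) x : sa x -> sa (r%:C *: x).
Proof. by rewrite /sa starZr => ->. Qed.

Lemma saM x y : sa x -> sa y -> x * y = y * x -> sa (x * y).
Proof. by rewrite /sa star_mul => -> ->. Qed.

Lemma sa_conj x y : sa y -> sa (star x * y * x).
Proof. by rewrite /sa !star_mul starK mulrA => ->. Qed.

Lemma nr_small (C : R) x : (forall e, 0 < e -> nr x <= C * e) -> x = 0.
Proof.
move=> h; apply: nr_le0; apply/ler_addgt0Pr => e e0.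
have C0 : 0 < `|C| + 1 by rewrite ltr_wpDl.
apply: le_trans (h (e / (`|C| + 1)) _) _; first exact: divr_gt0.
rewrite add0r mulrCA ler_piMr ?(ltW e0) // ler_pdivrMr // mul1r.
by rewrite (le_trans (ler_norm _)) // lerDl.
Qed.

(** The iteration [s |-> (z + s^2) / 2] converges to [1 - sqrt (1 - z)]; its
    increments are dominated by those of the same iteration on the scalar 1. *)
Fixpoint root_iter z n : A :=
  match n with
  | 0%N => 0
  | n.+1 => (2^-1)%:C *: (z + root_iter z n * root_iter z n)
  end.

Fixpoint root_bound n : R :=
  match n with 0%N => 0 | n.+1 => (1 + root_bound n ^+ 2) / 2 end.

Lemma root_bound01 n : 0 <= root_bound n <= 1.
Proof.
elim: n => [|n /andP[h0 h1]] /=; first by lra.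
by rewrite divr_ge0 ?addr_ge0 ?sqr_ge0 //=; nra.
Qed.

Lemma root_iter_comm z y n :
  z * y = y * z -> root_iter z n * y = y * root_iter z n.
Proof.
move=> h; elim: n => [|n IH] /=; first by rewrite mul0r mulr0.
by rewrite -scalerAl -scalerAr mulrDl mulrDr h -mulrA IH mulrA IH mulrA.
Qed.

Lemma root_iter_norm z n : nr z <= 1 -> nr (root_iter z n) <= root_bound n.
Proof.
move=> hz; elim: n => [|n IH] /=; first by rewrite nr0.
rewrite nrZr ger0_norm ?invr_ge0 // mulrC ler_pM2r ?invr_gt0 //.
apply: le_trans (nrD _ _) _; apply: lerD => //.
by apply: le_trans (nrM _ _) _; rewrite expr2 ler_pM ?nr_ge0.
Qed.

(** The iterates commute, so [s1 * s1 - s0 * s0] factors as [(s1 - s0) * (s1 + s0)]; the scalar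
    iteration factors in the same way. *)
Lemma root_iter_step z n : nr z <= 1 ->
  nr (root_iter z n.+1 - root_iter z n) <= root_bound n.+1 - root_bound n.
Proof.
move=> hz; elim: n => [|n IH].
  by have := root_iter_norm 1 hz; rewrite /= !subr0.
set s1 := root_iter z n.+1; set s0 := root_iter z n in IH *.
have cm : s1 * s0 = s0 * s1.
  by apply/esym/root_iter_comm/esym/root_iter_comm.
have -> : root_iter z n.+2 - s1 = (2^-1)%:C *: ((s1 - s0) * (s1 + s0)).
  have -> : (s1 - s0) * (s1 + s0) = s1 * s1 - s0 * s0.
    by rewrite mulrDr !mulrBl cm addrA subrK.
  have e1 : s1 = (2^-1)%:C *: (z + s0 * s0) by [].
  have -> : root_iter z n.+2 = (2^-1)%:C *: (z + s1 * s1) by [].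
  by rewrite [in X in _ - X]e1; nc.
rewrite nrZr ger0_norm ?invr_ge0 //.
have hs : nr (s1 + s0) <= root_bound n.+1 + root_bound n.
  by apply: le_trans (nrD _ _) _; apply: lerD; exact: root_iter_norm.
have := ler_pM (nr_ge0 _) (nr_ge0 _) IH hs.
move/(le_trans (nrM _ _)).
have -> : root_bound n.+2 = (1 + root_bound n.+1 ^+ 2) / 2 by [].
have : root_bound n.+1 = (1 + root_bound n ^+ 2) / 2 by [].
by move: (root_bound n.+1) (root_bound n) (nr _) => a b c; lra.
Qed.

(** The root is [1 - s] for the limit [s] of the iteration, since [s = (z + s^2) / 2] means
    [(1 - s)^2 = 1 - z]. Self-adjointness and commutation pass to the limit. The bound on [1 - w]
    permits taking a root of [w] in turn. *)
Lemma root1B z : sa z -> nr z <= 1 ->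
  exists w, [/\ sa w, w * w = 1 - z, nr (1 - w) <= 1 &
    forall y, z * y = y * z -> w * y = y * w].
Proof.
move=> saz hz.
have [s hs] := nr_summable (fun n => root_iter_step n hz)
  (fun n => proj2 (andP (root_bound01 n))).
have app e : 0 < e -> exists n, [/\ nr (s - root_iter z n) <= e,
    nr (s - root_iter z n.+1) <= e & nr (root_iter z n) <= 1].
  move=> /hs[n hn]; exists n; split; rewrite ?hn //.
  by rewrite (le_trans (root_iter_norm _ hz)) //; case/andP: (root_bound01 n).
have s1 : nr s <= 1.
  apply/ler_addgt0Pr => e /app[n [h _ h1]].
  by apply: le_trans (nr_leB _ (root_iter z n)) _; exact: lerD.
have fix_s : s - (2^-1)%:C *: (z + s * s) = 0.
  apply: (@nr_small 2) => e /app[n [h h' h1]].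
  set t := root_iter z n in h h1.
  have -> : s - (2^-1)%:C *: (z + s * s) = (s - root_iter z n.+1)
      - (2^-1)%:C *: ((s - t) * t + s * (s - t)) by rewrite /= -/t; nc.
  apply: le_trans (nrB _ _) _; rewrite nrZr ger0_norm ?invr_ge0 //.
  have := nrD ((s - t) * t) (s * (s - t)).
  have := nrM (s - t) t; have := nrM s (s - t).
  have := nr_ge0 (s - t); have := nr_ge0 s; have := nr_ge0 t.
  move: h h' h1 s1; move: (nr (s - t)) (nr _) (nr t) (nr s).
  move=> a b c d; move: (nr _) (nr _) (nr _) => *; nra.
have sas : star s - s = 0.
  apply: (@nr_small 2) => e /app[n [h _ _]].
  have st : star (root_iter z n) = root_iter z n.
    elim: n {h} => [|n IH] /=; first exact: star0.
    by rewrite starZr starD star_mul IH saz.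
  have -> : star s - s = star (s - root_iter z n) - (s - root_iter z n).
    by rewrite starB st opprB addrA subrK.
  by apply: le_trans (nrB _ _) _; rewrite nr_star; lra.
have coms y : z * y = y * z -> s * y - y * s = 0.
  move=> zy; apply: (@nr_small (2 * nr y)) => e /app[n [h _ _]].
  have -> : s * y - y * s = (s - root_iter z n) * y - y * (s - root_iter z n).
    by rewrite mulrBl mulrBr (root_iter_comm n zy) opprB addrA subrK.
  apply: le_trans (nrB _ _) _.
  have := nrM (s - root_iter z n) y; have := nrM y (s - root_iter z n).
  have := nr_ge0 y; move: h; move: (nr _) (nr _) (nr _) (nr _) => *; nra.
exists (1 - s); split.
- by apply: saB; [exact: sa1 | apply/subr0_eq].
- have -> : (1 - s) * (1 - s) = 1 - z - 2 *: (s - (2^-1)%:C *: (z + s * s)).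
    by nc; field.
  by rewrite fix_s scaler0 subr0.
- by rewrite opprB addrC subrK.
- by move=> y /coms/subr0_eq h; rewrite mulrBl mulrBr h mul1r mulr1.
Qed.

End CStar.

(** * Positive elements *)

Section Positivity.
Variables (R : realType) (A : cstarAlgType R).
Implicit Types a b p q u v x y z : A.
Local Notation cst r := ((r : R)%:C *: (1 : A)).

(** Defining positive elements as self-adjoint squares avoids the spectrum; roots that commute with
    everything commuting with [y] take the place of functional calculus. *)
Definition pos y := exists2 n, sa n & n * n = y.

Lemma pos_sa y : pos y -> sa y.
Proof. by move=> [n hn <-]; apply: saM. Qed.

Lemma sa_cst r : sa (cst r).
Proof. exact/saZ/sa1. Qed.

Lemma cst_comm r x : cst r * x = x * cst r.
Proof. by nc. Qed.

Lemma posZ (r : R) y : 0 <= r -> pos y -> pos (r%:C *: y).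
Proof.
move=> r0 [n hn <-]; exists ((Num.sqrt r)%:C *: n); first exact: saZ.
rewrite -scalerAl -scalerAr scalerA; congr (_ *: _).
by rewrite -rmorphM -expr2 /= sqr_sqrtr.
Qed.

Lemma pos0 : pos 0.
Proof. by exists 0; [exact: sa0 | exact: mulr0]. Qed.

(** After scaling by [1 / c], [root1B] is applied twice: once for the root [w], once to [1 - w] to
    see that [w] is itself a square. *)
Lemma root_cstB z (c : R) : sa z -> nr z <= c ->
  exists w, [/\ pos w, w * w = cst c - z &
    forall y, z * y = y * z -> w * y = y * w].
Proof.
move=> saz hz; have := le_trans (nr_ge0 _) hz.
rewrite le_eqVlt => /predU1P[c0|c0].
  have z0 : z = 0 by apply: nr_le0; rewrite c0.
  exists 0; split; first exact: pos0.
  - by rewrite z0 -c0 rmorph0 scale0r mulr0 subr0.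
  - by move=> y _; rewrite mulr0 mul0r.
have cV0 : 0 <= c^-1 by rewrite invr_ge0 ltW.
have [||w [saw ww w1 cw]] := @root1B _ _ ((c^-1)%:C *: z).
- exact: saZ.
- by rewrite nrZr ger0_norm // mulrC ler_pdivrMr // mul1r.
have [v [sav vv _ _]] := root1B (saB (sa1 _) saw) w1.
exists ((Num.sqrt c)%:C *: w); split.
- apply: posZ (sqrtr_ge0 _) _; exists v => //.
  by rewrite vv opprB addrC subrK.
- rewrite -scalerAl -scalerAr scalerA ww -rmorphM -expr2 /=.
  rewrite sqr_sqrtr ?(ltW c0) //.
  rewrite scalerBr scalerA -rmorphM /= divff ?lt0r_neq0 //.
  by rewrite scale1r.
- move=> y zy; rewrite -scalerAl -scalerAr cw //.
  by rewrite -scalerAl -scalerAr zy.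
Qed.

(** The element [u = a + i b] satisfies [star u * u = c], so the C*-identity gives its norm, and [a]
    is the mean of [u] and [star u]. Most norm estimates below reduce to this one. *)
Lemma sum_sq_norm (c : R) a b : sa a -> sa b -> a * b = b * a ->
  a * a + b * b = cst c -> nr a ^+ 2 <= `|c|.
Proof.
move=> ha hb ab e; pose u := a + 'i *: b.
have su : star u = a - 'i *: b by rewrite starD starZi ha hb.
have uu : star u * u = cst c.
  have -> : star u * u = a * a + b * b + 'i *: (a * b - b * a)
      - ('i ^+ 2 + 1) *: (b * b) by rewrite su /u; nc.
  by rewrite ab subrr scaler0 addr0 sqrCi addNr scale0r subr0.
have hu : nr u ^+ 2 = `|c| by rewrite -nr_cstar uu nr_scalar.
rewrite -hu ler_pXn2r ?nnegrE ?nr_ge0 //.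
have -> : a = (2^-1)%:C *: (u + star u).
  by rewrite su /u; nc; field.
rewrite nrZr ger0_norm ?invr_ge0 //.
by have := nrD u (star u); rewrite nr_star; lra.
Qed.

(** If [c < 0], the squares of [n] and of the scalar [sqrt (- c)] add up to 0, which forces that
    scalar to vanish. *)
Lemma pos_cst_ge0 (c : R) : pos (cst c) -> 0 <= c.
Proof.
move=> [n sn nn]; rewrite leNgt; apply/negP => c0.
have h : 0 <= - c by lra.
have := @sum_sq_norm 0 (cst (Num.sqrt (- c))) n (sa_cst _) sn (cst_comm _ _).
rewrite -scalerAl mul1r scalerA -rmorphM -expr2 /= sqr_sqrtr // nn -scalerDl.
rewrite -rmorphD addNr => /(_ erefl).
by rewrite nr_scalar real_normK ?num_real // sqr_sqrtr // normr0; lra.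
Qed.

Lemma sub1_sq_norm y : sa y -> nr y <= 1 -> nr (1 - y * y) <= 1.
Proof.
move=> hy y1.
have yy : nr (y * y) <= 1 by rewrite sa_sq // expr_le1 ?nr_ge0.
have [w [/pos_sa sw ww cw]] := root_cstB (saM hy hy erefl) yy.
have wy : w * y = y * w by apply: cw; rewrite mulrA.
have /sum_sq_norm : w * w + y * y = cst 1 by rewrite ww subrK.
move=> /(_ sw hy wy); rewrite -sa_sq // ww normr1.
by rewrite rmorph1 scale1r.
Qed.

(** With its converse [pos_nr_dist] this characterises positivity by a norm inequality, from which
    sums of positive elements are seen to be positive. *)
Lemma pos_dist y (c : R) : pos y -> nr y <= c -> nr (cst c - y) <= c.
Proof.
move=> [n sn <-] hy; have := le_trans (nr_ge0 _) hy.
rewrite le_eqVlt => /predU1P[c0|c0].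
  have -> : n * n = 0 by apply: nr_le0; rewrite c0.
  by rewrite subr0 nr_scalar ger0_norm // -c0.
pose m := (Num.sqrt c^-1)%:C *: n.
have mm : m * m = (c^-1)%:C *: (n * n).
  rewrite -scalerAl -scalerAr scalerA -rmorphM -expr2 /= sqr_sqrtr //.
  by rewrite invr_ge0 ltW.
have sm : sa m by exact: saZ.
have m1 : nr m <= 1.
  rewrite -(@expr_le1 _ 2) ?nr_ge0 // -sa_sq // mm nrZr.
  rewrite ger0_norm ?invr_ge0 ?(ltW c0) //.
  by rewrite [X in X <= _]mulrC ler_pdivrMr // mul1r.
have -> : cst c - n * n = c%:C *: (1 - m * m).
  rewrite mm scalerBr scalerA -rmorphM /= divff ?lt0r_neq0 //.
  by rewrite scale1r.
rewrite nrZr (ger0_norm (ltW c0)) ler_piMr ?(ltW c0) //.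
exact: sub1_sq_norm.
Qed.

Lemma pos_root y : pos y ->
  exists w, [/\ pos w, w * w = y & forall z, y * z = z * y -> w * z = z * w].
Proof.
move=> py; have sy := pos_sa py.
have [w [pw ww cw]] :=
  root_cstB (saB (sa_cst _) sy) (pos_dist py (lexx (nr y))).
exists w; split=> // [|z yz]; first by rewrite ww opprB addrC subrK.
by apply: cw; rewrite mulrBl mulrBr yz cst_comm.
Qed.

Lemma pos_nr_dist y (c : R) : sa y -> nr (cst c - y) <= c -> pos y.
Proof.
move=> sy h; have [w [/pos_sa sw ww _]] := root_cstB (saB (sa_cst _) sy) h.
by exists w => //; rewrite ww opprB addrC subrK.
Qed.

Lemma posD x y : pos x -> pos y -> pos (x + y).
Proof.
move=> px py; apply: (@pos_nr_dist _ (nr x + nr y)).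
  by apply: saD; exact: pos_sa.
have -> : cst (nr x + nr y) - (x + y) = (cst (nr x) - x) + (cst (nr y) - y).
  by rewrite rmorphD scalerDl opprD addrACA.
by apply: le_trans (nrD _ _) _; apply: lerD; exact: pos_dist.
Qed.

Lemma pos_sum (I : eqType) (s : seq I) (F : I -> A) :
  (forall i, i \in s -> pos (F i)) -> pos (\sum_(i <- s) F i).
Proof.
move=> h; rewrite big_seq; apply: big_ind => //; [exact: pos0 | exact: posD].
Qed.

Lemma nr_cstB_pos y (c : R) : sa y -> nr y <= c -> pos (cst c - y).
Proof.
by move=> sy /(root_cstB sy)[w [/pos_sa sw <- _]]; exists w.
Qed.

Lemma nr_cstD_pos y (c : R) : sa y -> nr y <= c -> pos (cst c + y).
Proof.
move=> sy hy; rewrite -(opprK y); apply: nr_cstB_pos; first exact: saN.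
by rewrite nrN.
Qed.

(** Commuting roots of [y] and of [c - y] have squares adding up to [c]. *)
Lemma pos_nr_le y (c : R) : pos y -> pos (cst c - y) -> nr y <= c.
Proof.
move=> py pc; have c0 : 0 <= c.
  by apply: pos_cst_ge0; rewrite -(subrK y (cst c)); exact: posD.
have [a sa_a aa] := py; have [b [/pos_sa sb bb cb]] := pos_root pc.
have ab : a * b = b * a.
  by apply/esym/cb; rewrite mulrBl mulrBr cst_comm -aa mulrA.
have := sum_sq_norm sa_a sb ab; rewrite aa bb addrC subrK => /(_ _ erefl).
by rewrite -sa_sq // aa ger0_norm.
Qed.

(** With [a] and [b] roots of [c - y] and [c + y], all commuting, [y^2 + (a b)^2 = c^2]. *)
Lemma nr_le_pos y (c : R) : sa y -> pos (cst c - y) -> pos (cst c + y) ->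
  nr y <= c.
Proof.
move=> sy p1 p2; have c0 : 0 <= c.
  have := posD p1 p2; rewrite addrACA addNr addr0 -scalerDl -rmorphD.
  by move/pos_cst_ge0; lra.
have [a [/pos_sa sa_a aa ca]] := pos_root p1; have [b sb bb] := p2.
have yb : y * b = b * y.
  have -> : y = b * b - cst c by rewrite bb addrC addKr.
  by rewrite mulrBl mulrBr mulrA cst_comm.
have ab : a * b = b * a by apply: ca; rewrite mulrBl mulrBr cst_comm yb.
have yab : y * (a * b) = a * b * y.
  by rewrite -mulrA -yb !mulrA ca // mulrBl mulrBr cst_comm.
have /(sum_sq_norm sy (saM sa_a sb ab) yab) : 
    y * y + a * b * (a * b) = cst (c ^+ 2).
  have -> : a * b * (a * b) = (a * a) * (b * b).
    by rewrite mulrA -(mulrA a b a) -ab !mulrA.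
  by rewrite aa bb; nc.
by rewrite normrX ger0_norm // ler_pXn2r ?nnegrE ?nr_ge0.
Qed.

Lemma pos_anti y : pos y -> pos (- y) -> y = 0.
Proof.
move=> p1 p2; apply/nr_le0/nr_le_pos; first exact: pos_sa.
- by rewrite rmorph0 scale0r add0r.
- by rewrite rmorph0 scale0r add0r.
Qed.

Lemma pos_nr_lb y (c : R) : 0 <= c -> sa y -> pos (y - cst c) -> c <= nr y.
Proof.
move=> c0 sy p; have := posD p (nr_cstB_pos sy (lexx (nr y))).
rewrite addrC addrA subrK -scalerBl -rmorphB => /pos_cst_ge0.
by rewrite subr_ge0.
Qed.

Lemma pos_nr_cstD y (c : R) : pos y -> nr y + c <= nr (y + cst c).
Proof.
move=> py; have sy := pos_sa py.
have := nr_cstB_pos (saD sy (sa_cst c)) (lexx _).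
rewrite opprD addrCA addrC -scalerBl -rmorphB => /(pos_nr_le py).
by lra.
Qed.

(** With [w] the root of [y^2], which plays the role of the absolute value, [p] and [q] are
    [(w + y) / 2] and [(w - y) / 2]. Positivity is recorded for [p + q] only; [pos_cube] turns it
    into positivity of the cubes. *)
Lemma pos_split y : sa y -> exists p q, [/\ sa p, sa q, y = p - q,
  p * q = 0 /\ q * p = 0 & pos (p + q)].
Proof.
move=> sy; have [|w [pw ww cw]] := @pos_root (y * y); first by exists y.
have sw := pos_sa pw; have wy : w * y = y * w by apply: cw; rewrite mulrA.
exists ((2^-1)%:C *: (w + y)), ((2^-1)%:C *: (w - y)); split.
- exact/saZ/saD.
- exact/saZ/saB.
- by nc; field.
- have e1 : w * y - y * w = 0 by rewrite wy subrr.
  have e2 : w * w - y * y = 0 by rewrite ww subrr.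
  split.
    transitivity ((4^-1)%:C *: (w * w - y * y) - (4^-1)%:C *: (w * y - y * w)).
      by nc; field.
    by rewrite e1 e2 scaler0 subrr.
  transitivity ((4^-1)%:C *: (w * w - y * y) + (4^-1)%:C *: (w * y - y * w)).
    by nc; field.
  by rewrite e1 e2 scaler0 addr0.
- have -> // : (2^-1)%:C *: (w + y) + (2^-1)%:C *: (w - y) = w.
  by nc; field.
Qed.

(** A root [n] of [p + q] commutes with [p], and [(n p)^2 = (p + q) p^2 = p^3]. *)
Lemma pos_cube p q : sa p -> p * q = 0 -> q * p = 0 -> pos (p + q) ->
  pos (p * p * p).
Proof.
move=> sp pq qp ppq; have [n [/pos_sa sn nn cn]] := pos_root ppq.
have np : n * p = p * n by apply: cn; rewrite mulrDl mulrDr pq qp.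
exists (n * p); first exact: saM.
have -> : n * p * (n * p) = n * n * p * p.
  by rewrite mulrA -(mulrA n p n) -np !mulrA.
by rewrite nn !mulrDl qp mul0r addr0.
Qed.

Lemma cube_eq0 p : sa p -> p * p * p = 0 -> p = 0.
Proof.
move=> sp h; have : nr (p * p * (p * p)) = nr p ^+ 2 ^+ 2.
  by rewrite sa_sq ?sa_sq //; exact: saM.
rewrite mulrA h mul0r nr0 => /esym/eqP.
by rewrite !expf_eq0 /= => /eqP/nr0_eq0.
Qed.

End Positivity.

(** * Squares and conjugation *)

Section Squares.
Variables (R : realType) (A : cstarAlgType R).
Implicit Types a b k p q t u v w x y z : A.
Local Notation cst r := ((r : R)%:C *: (1 : A)).

(** With [M = |v|^2], [P = - v^* v] and [Q = v v^*] both positive, the product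
    [Q (Q + M)] has norm at least [2 M^2], whereas the norm of its square
    [v (M - P)^2 v^* v v^*] is at most [M^4]. *)
Lemma neg_star_eq0 v : pos (- (star v * v)) -> v = 0.
Proof.
move=> pP; set P := - (star v * v) in pP.
pose M := nr v ^+ 2; pose Q := v * star v.
have M0 : 0 <= M by exact: sqr_ge0.
have nP : nr P = M by rewrite nrN nr_cstar.
have nQ : nr Q = M by rewrite /Q -{1}(starK v) nr_cstar nr_star.
have pQ : pos Q.
  pose a := (2^-1)%:C *: (v + star v).
  pose d := star v - v; pose b := (2^-1)%:C *: ('i *: d).
  have sqa : sa a by rewrite /sa starZr starD starK addrC.
  have sqb : sa b.
    by rewrite /sa starZr starZi starB starK -scalerN opprB.
  (* With [a] and [b] the real and imaginary parts of [v],
     [star v * v + v * star v = 2 (a^2 + b^2)]. *)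
  have -> : Q = 2%:C *: (a * a + b * b) + P.
    have -> : b * b = - (((2^-1)%:C * (2^-1)%:C) *: (d * d)).
      transitivity (('i ^+ 2 * ((2^-1)%:C * (2^-1)%:C)) *: (d * d)).
        by rewrite /b; nc.
      by rewrite sqrCi mulN1r scaleNr.
    by rewrite /a /d /P /Q; nc; field.
  apply: posD => //; apply: posZ; first by [].
  by apply: posD; [exists a | exists b].
have sQ := pos_sa pQ.
(* Completing the square: [Z^2 = Q (Q + M) + M^2 / 4], and [Z] has norm at least [3 M / 2]. *)
have low : 2 * M ^+ 2 <= nr (Q * (Q + cst M)).
  pose Z := Q + cst (M / 2).
  have hZ : nr Q + M / 2 <= nr Z by exact: pos_nr_cstD.
  have := sa_sq (saD sQ (sa_cst A (M / 2))); rewrite -/Z.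
  have -> : Z * Z = Q * (Q + cst M) + cst (M ^+ 2 / 4).
    by rewrite /Z; nc; field.
  have := nrD (Q * (Q + cst M)) (cst (M ^+ 2 / 4)).
  rewrite nr_scalar ger0_norm ?divr_ge0 ?sqr_ge0 //.
  by rewrite nQ in hZ => hN hE; move: hN; rewrite hE; clear -hZ M0; nra.
have up : nr (Q * (Q + cst M)) ^+ 2 <= M ^+ 4.
  rewrite -sa_sq; last first.
    by apply: saM => //; [apply/saD/sa_cst | nc].
  have -> : Q * (Q + cst M) * (Q * (Q + cst M)) =
      v * ((cst M - P) * (cst M - P)) * star v * Q.
    by rewrite /Q /P; nc.
  have h : nr (cst M - P) <= M by apply: pos_dist; rewrite ?nP.
  have h2 : nr ((cst M - P) * (cst M - P)) <= M ^+ 2.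
    by rewrite expr2 (le_trans (nrM _ _)) // ler_pM ?nr_ge0.
  have -> : M ^+ 4 = nr v * M ^+ 2 * nr v * M by rewrite /M; ring.
  apply: le_trans (nrM _ _) _; rewrite nQ ler_wpM2r //.
  apply: le_trans (nrM _ _) _; rewrite nr_star ler_wpM2r ?nr_ge0 //.
  by apply: le_trans (nrM _ _) _; rewrite ler_wpM2l ?nr_ge0.
have : M = 0.
  have M2 := sqr_ge0 M.
  have : (2 * M ^+ 2) ^+ 2 <= M ^+ 4.
    have N0 : 0 <= 2 * M ^+ 2 by lra.
    apply: le_trans up.
    by rewrite ler_pXn2r // nnegrE nr_ge0.
  have -> : (2 * M ^+ 2) ^+ 2 = 4 * M ^+ 4 by ring.
  move=> h; have : M ^+ 4 <= 0 by lra.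
  by rewrite exprn_even_le0 //= => /eqP.
by move/eqP; rewrite expf_eq0 /= => /eqP/nr0_eq0.
Qed.

(** If [q] is the negative part of [star x * x], then [star (x q) * (x q) = - q^3] with [q^3]
    positive, so [neg_star_eq0] gives [x q = 0], whence [q^3 = 0] and [q = 0]. *)
Lemma pos_star x : pos (star x * x).
Proof.
have sx : sa (star x * x) by rewrite /sa star_mul starK.
have [p [q [sp sq e [pq qp] ppq]]] := pos_split sx.
suff q0 : q = 0 by rewrite e q0 subr0; move: ppq; rewrite q0 addr0.
have pq3 : pos (q * q * q) by apply: (@pos_cube _ _ q p) => //; rewrite addrC.
have e3 : star (x * q) * (x * q) = - (q * q * q).
  rewrite star_mul sq mulrA -(mulrA q) e mulrBr mulrBl.
  by rewrite qp mul0r sub0r.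
have /neg_star_eq0 v0 : pos (- (star (x * q) * (x * q))) by rewrite e3 opprK.
apply: cube_eq0 => //; move: e3; rewrite v0 mulr0 => /esym/eqP.
by rewrite oppr_eq0 => /eqP.
Qed.

Lemma pos_conj x y : pos y -> pos (star x * y * x).
Proof.
move=> [n sn <-]; have := pos_star (n * x).
by rewrite star_mul sn !mulrA.
Qed.

Definition conj_sum (s : seq A) z := \sum_(x <- s) star x * z * x.

Lemma conj_sumD s y z : conj_sum s (y + z) = conj_sum s y + conj_sum s z.
Proof.
rewrite /conj_sum -big_split; apply: eq_bigr => x _.
by rewrite mulrDr mulrDl.
Qed.

Lemma conj_sumZ s (c : R[i]) z : conj_sum s (c *: z) = c *: conj_sum s z.
Proof.
rewrite /conj_sum scaler_sumr; apply: eq_bigr => x _.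
by rewrite -scalerAr -scalerAl.
Qed.

Lemma conj_sumB s y z : conj_sum s (y - z) = conj_sum s y - conj_sum s z.
Proof. by rewrite conj_sumD -scaleN1r conj_sumZ scaleN1r. Qed.

Lemma conj_sum_star s z : star (conj_sum s z) = conj_sum s (star z).
Proof.
rewrite /conj_sum star_sum; apply: eq_bigr => x _.
by rewrite !star_mul starK mulrA.
Qed.

Lemma conj_sum_pos s z : pos z -> pos (conj_sum s z).
Proof. by move=> pz; apply: pos_sum => x _; exact: pos_conj. Qed.

Lemma conj_sum_cst s (c : R[i]) :
  conj_sum s 1 = 1 -> conj_sum s (c *: 1) = c *: 1.
Proof. by rewrite conj_sumZ => ->. Qed.

Lemma sa_decomp z : exists a b, [/\ sa a, sa b, z = a + 'i *: b &
  nr a <= nr z /\ nr b <= nr z].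
Proof.
exists ((2^-1)%:C *: (z + star z)), ((2^-1)%:C *: ('i *: (star z - z))).
have nh x y : nr x = nr z -> nr y = nr z -> nr ((2^-1)%:C *: (x + y)) <= nr z.
  move=> hx hy; rewrite nrZr ger0_norm ?invr_ge0 //.
  by have := nrD x y; rewrite hx hy; lra.
have ni x : nr ('i *: x) = nr x.
  by rewrite nrZ normCi mul1r.
split.
- by rewrite /sa starZr starD starK addrC.
- by rewrite /sa starZr starZi starB starK -scalerN opprB.
- transitivity ((2^-1)%:C *: (z + star z)
      + ('i ^+ 2 * (2^-1)%:C) *: (star z - z)).
    by rewrite sqrCi mulN1r; nc; field.
  by congr (_ + _); nc.
- split; first by rewrite nh ?nr_star.
  rewrite scalerBr nh ?ni ?nr_star //.
  by rewrite nrN ni.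
Qed.

(** A unital positive map is contractive on self-adjoint elements by the order bounds; the factor 2
    comes from adding real and imaginary parts. *)
Lemma conj_sum_le s z : conj_sum s 1 = 1 -> nr (conj_sum s z) <= 2 * nr z.
Proof.
move=> s1.
have h y : sa y -> nr (conj_sum s y) <= nr y.
  move=> sy; apply: nr_le_pos.
  - by rewrite /sa conj_sum_star sy.
  - rewrite -(conj_sum_cst _ s1) -conj_sumB; apply: conj_sum_pos.
    exact: nr_cstB_pos.
  - rewrite -(conj_sum_cst _ s1) -conj_sumD; apply: conj_sum_pos.
    exact: nr_cstD_pos.
have [a [b [ha hb -> [na nb]]]] := sa_decomp z.
rewrite conj_sumD conj_sumZ; apply: le_trans (nrD _ _) _.
rewrite nrZ normCi mul1r.
by have := h _ ha; have := h _ hb; lra.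
Qed.

(** The partial sums [u] of the geometric series are dominated by the scalar ones [sg]. *)
Lemma neumann t : nr t < 1 -> exists q, (1 - t) * q = 1 /\ q * (1 - t) = 1.
Proof.
move=> t1; have nt := nr_ge0 t; have d0 : 0 < 1 - nr t by lra.
pose u := fix u n : A := if n is n.+1 then 1 + t * u n else 0.
pose sg := fix sg n : R := if n is n.+1 then 1 + nr t * sg n else 0.
have uS n : u n.+1 = 1 + t * u n by [].
have sgS n : sg n.+1 = 1 + nr t * sg n by [].
have hu n : nr (u n.+1 - u n) <= sg n.+1 - sg n.
  elim: n => [|n IH]; first by rewrite /= !mulr0 !addr0 !subr0 nr1.
  have -> : u n.+2 - u n.+1 = t * (u n.+1 - u n).
    by rewrite (uS n.+1) {2}(uS n) mulrBr opprD addrACA subrr add0r.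
  apply: le_trans (nrM _ _) _; rewrite (sgS n.+1) {2}(sgS n).
  by have := ler_wpM2l nt IH; lra.
have hb n : sg n <= (1 - nr t)^-1.
  elim: n => [|n IH]; first by rewrite /= invr_ge0 ltW.
  have := ler_wpM2l nt IH; rewrite sgS.
  have : (1 - nr t) * (1 - nr t)^-1 = 1 by rewrite divff ?lt0r_neq0.
  by rewrite mulrBl mul1r; lra.
have [q hq] := nr_summable hu hb; exists q.
have cu n : t * u n = u n * t.
  elim: n => [|n IH]; first by rewrite /= mulr0 mul0r.
  by rewrite uS mulrDr mulrDl mulr1 mul1r {1}IH mulrA.
have e1 : q - (1 + t * q) = 0.
  apply: (@nr_small _ _ 2) => e /hq[n hn].
  have -> : q - (1 + t * q) = (q - u n.+1) - t * (q - u n).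
    by rewrite uS; nc.
  apply: le_trans (nrB _ _) _; have := nrM t (q - u n).
  have := hn _ (leqnn n); have := hn _ (leqnSn n).
  move: (nr (t * _)) (nr (q - u n.+1)) (nr_ge0 (q - u n)).
  by move: (nr _) => x y z; nra.
have e2 : t * q - q * t = 0.
  apply: (@nr_small _ _ 2) => e /hq[n hn].
  have -> : t * q - q * t = t * (q - u n) - (q - u n) * t.
    by rewrite mulrBl mulrBr cu; nc.
  apply: le_trans (nrB _ _) _; have := nrM t (q - u n).
  have := nrM (q - u n) t; have := hn _ (leqnn n).
  move: (nr (t * _)) (nr (_ * t)) (nr_ge0 (q - u n)).
  by move: (nr _) => x y z; nra.
have e3 : (1 - t) * q = 1.
  by rewrite mulrBl mul1r {1}(subr0_eq e1) addrK.
by split => //; rewrite mulrBr mulr1 -(subr0_eq e2) -e3 mulrBl mul1r.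
Qed.

(** With [M] the norm of [1 + k], the element [t = 1 - (1 + k) / M] has norm at most
    [(M - 1) / M < 1]. Here [q] is the inverse of [1 - t] and [w] its root, so [w q] is an inverse
    square root of [1 - t], and scaling by [M^(-1/2)] gives one of [1 + k]. *)
Lemma pos_inv_root k : pos k -> exists2 r, sa r & r * (1 + k) * r = 1.
Proof.
move=> pk; have sk := pos_sa pk; pose S := 1 + k; pose M := nr S.
have sS : sa S by apply: saD => //; exact: sa1.
have M1 : 1 <= M.
  apply: pos_nr_lb => //; rewrite rmorph1 scale1r.
  by rewrite /S addrC addKr.
have M0 : 0 < M by lra.
have MV : M^-1 * M = 1 by rewrite mulVf ?lt0r_neq0.
pose t := (M^-1)%:C *: (cst M - S).
have MV0 : 0 <= M^-1 by rewrite invr_ge0 ltW.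
have st : sa t by apply/saZ/saB/sS/sa_cst.
have t1 : nr t < 1.
  rewrite nrZr ger0_norm // mulrC ltr_pdivrMr // mul1r.
  have : nr (cst M - S) <= M - 1.
    apply: pos_nr_le; first exact: nr_cstB_pos.
    have -> : cst (M - 1) - (cst M - S) = k by rewrite /S; nc.
    by [].
  by lra.
have tS : 1 - t = (M^-1)%:C *: S.
  rewrite /t scalerBr scalerA -rmorphM /= MV rmorph1 scale1r.
  by rewrite opprB addrC subrK.
have [w [/pos_sa sw ww cw]] := @root_cstB _ _ t 1 st (ltW t1).
rewrite rmorph1 scale1r in ww.
have [q [tq qt]] := neumann t1.
have sq : sa q.
  rewrite /sa -[LHS]mulr1 -tq mulrA -[1 - t](saB (sa1 A) st) -star_mul tq.
  by rewrite star1 mul1r.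
have wt : w * (1 - t) = (1 - t) * w by rewrite mulrBl mulrBr mulr1 mul1r cw.
have wq : w * q = q * w.
  by rewrite -[LHS]mul1r -qt -!mulrA (mulrA _ w) -wt -mulrA tq mulr1.
have key : (w * q) * (1 - t) * (w * q) = 1.
  by rewrite -(mulrA w q) qt mulr1 mulrA ww.
exists ((Num.sqrt M^-1)%:C *: (w * q)); first by apply/saZ/saM.
rewrite -/S -scalerAr -2!scalerAl scalerA -rmorphM -expr2 /= sqr_sqrtr //.
by rewrite -key tS -scalerAr -scalerAl.
Qed.

End Squares.

(** * Unital star-homomorphisms *)

Section Morphisms.
Variables (R : realType) (A T : cstarAlgType R).
Local Notation cst r := ((r : R)%:C *: 1).

Definition unital_star_hom (f : A -> T) :=
  [/\ {morph f : x y / x + y}, forall c x, f (c *: x) = c *: f x,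
      {morph f : x y / x * y}, {morph f : x / star x} & f 1 = 1].

Variable f : A -> T.
Hypothesis hf : unital_star_hom f.

Lemma homB x y : f (x - y) = f x - f y.
Proof.
by have [hD hZ _ _ _] := hf; rewrite hD -scaleN1r hZ scaleN1r.
Qed.

Lemma hom_sum (I : Type) (s : seq I) (F : I -> A) :
  f (\sum_(i <- s) F i) = \sum_(i <- s) f (F i).
Proof.
have [hD hZ _ _ _] := hf; elim: s => [|i s IH].
  by rewrite !big_nil -(scale0r (0 : A)) hZ scale0r.
by rewrite !big_cons hD IH.
Qed.

Lemma hom_sa x : sa x -> sa (f x).
Proof. by have [_ _ _ hs _] := hf; rewrite /sa -hs => ->. Qed.

Lemma hom_pos x : pos x -> pos (f x).
Proof.
have [_ _ hM _ _] := hf.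
by move=> [n sn <-]; exists (f n); [exact: hom_sa | rewrite -hM].
Qed.

Lemma hom_cst r : f (cst r) = cst r.
Proof. by have [_ hZ _ _ h1] := hf; rewrite hZ h1. Qed.

Lemma hom_nr_le x : nr (f x) <= nr x.
Proof.
have [hD hZ hM hs h1] := hf.
rewrite -(@ler_pXn2r _ 2) ?nnegrE ?nr_ge0 // -!nr_cstar -hs -hM.
have : sa (star x * x) by rewrite /sa star_mul starK.
move: (star x * x) => y sy; apply: nr_le_pos; first exact: hom_sa.
  by rewrite -hom_cst -homB; apply/hom_pos/nr_cstB_pos.
by rewrite -hom_cst -hD; apply/hom_pos/nr_cstD_pos.
Qed.

(** Injectivity makes [f] reflect positivity: if [f y] is positive and [q] is the negative part of
    [y], then [f (q * y * q) = - f (q * q * q)] is both positive and negative, so [q = 0]. Order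
    bounds, and with them norms, then transfer back to [A]. *)
Lemma hom_isometric x : (forall y, f y = 0 -> y = 0) -> nr (f x) = nr x.
Proof.
move=> inj; have [hD hZ hM hs h1] := hf.
apply/eqP; rewrite eq_le hom_nr_le /=.
rewrite -(@ler_pXn2r _ 2) ?nnegrE ?nr_ge0 // -!nr_cstar -hs -hM.
have : sa (star x * x) by rewrite /sa star_mul starK.
have refl y : sa y -> pos (f y) -> pos y.
  move=> sy py; have [p [q [sp sq e [pq qp] ppq]]] := pos_split sy.
  suff q0 : q = 0 by rewrite e q0 subr0; move: ppq; rewrite q0 addr0.
  have pq3 : pos (q * q * q) by apply: (@pos_cube _ _ q p) => //; rewrite addrC.
  have e3 : q * y * q = - (q * q * q).
    by rewrite e mulrBr mulrBl qp mul0r sub0r.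
  apply/cube_eq0/inj/pos_anti => //; first exact: hom_pos.
  have := pos_conj (f q) py; rewrite -hs sq -!hM e3.
  by rewrite -[- _]sub0r homB -(subrr (0 : A)) homB subrr sub0r.
move: (star x * x) => y sy; apply: nr_le_pos => //.
  apply: refl; first exact/saB/sy/sa_cst.
  by rewrite homB hom_cst; apply: nr_cstB_pos; first exact: hom_sa.
apply: refl; first exact/saD/sy/sa_cst.
by rewrite hD hom_cst; apply: nr_cstD_pos; first exact: hom_sa.
Qed.

End Morphisms.

(** * Excision *)

Section Excision.
Variables (R : realType) (E : cstarAlgType R).
Implicit Types a b e u v x y z : E.
Implicit Types s : seq E.
Local Notation cst r := ((r : R)%:C *: (1 : E)).

Definition unit_family a s :=
  (forall x, x \in s -> exists y, x = a * y) /\ conj_sum s 1 = 1.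

(** This is why an estimate valid for all families of [a] survives right multiplication of [a]. *)
Lemma unit_familyM a b s : unit_family (a * b) s -> unit_family a s.
Proof.
by move=> [h h1]; split=> // x /h[y ->]; exists (b * y); rewrite mulrA.
Qed.

Lemma unit_family_pos a s z : unit_family a s -> pos (star a * z * a) ->
  pos (conj_sum s z).
Proof.
move=> [h _] pz; apply: pos_sum => x /h[y ->].
have -> : star (a * y) * z * (a * y) = star y * (star a * z * a) * y.
  by rewrite star_mul !mulrA.
exact: pos_conj.
Qed.

(** Replaces a case distinction on the spectrum: the positive part [p] of [y] either vanishes or
    satisfies [p y p = p^3], nonzero and positive. *)
Lemma pos_or_compress y : sa y ->
  pos (- y) \/ exists b, [/\ sa b, pos (b * y * b) & b * y * b != 0].
Proof.
move=> sy; have [p [q [sp sq e [pq qp] ppq]]] := pos_split sy.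
have [p0|p0] := eqVneq p 0.
  by left; rewrite e p0 sub0r opprK; move: ppq; rewrite p0 add0r.
right; exists p; have -> : p * y * p = p * p * p.
  by rewrite e mulrBr pq subr0.
split=> //; first exact: (@pos_cube _ _ p q).
by apply: contra_neq p0; exact: cube_eq0.
Qed.

(** Bisection of the interval [[-r, r]]: compressed by [a * b], the element [e] lies between the
    ends of an interval with midpoint [l] and half-length [r / 2^k]. *)
Lemma excise_bisect a e (r : R) k : a != 0 -> sa e -> nr e <= r ->
  exists b (l : R), [/\ a * b != 0,
    pos (star (a * b) * (e - cst (l - r / 2 ^+ k)) * (a * b)) &
    pos (star (a * b) * (cst (l + r / 2 ^+ k) - e) * (a * b))].
Proof.
move=> a0 se er; elim: k => [|k [b [l [ab0 p1 p2]]]].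
  exists 1, 0; rewrite mulr1 sub0r add0r expr0 divr1; split=> //.
    by apply: pos_conj; rewrite rmorphN scaleNr opprK addrC; exact: nr_cstD_pos.
  by apply: pos_conj; exact: nr_cstB_pos.
set d := r / 2 ^+ k in p1 p2.
have -> : r / 2 ^+ k.+1 = d / 2.
  by rewrite /d exprSr invfM mulrA.
have sy : sa (star (a * b) * (e - cst l) * (a * b)).
  exact/sa_conj/saB/sa_cst.
(* Either the compression of [e - l] is at most 0 and the lower half is kept with the same [b], or
   cutting down by [c] leads to the upper half. *)
have [neg|[c [sc pc c0]]] := pos_or_compress sy.
  exists b, (l - d / 2); split=> //.
    by have -> : l - d / 2 - d / 2 = l - d by lra.
  have -> : l - d / 2 + d / 2 = l by lra.
  by move: neg; rewrite -mulNr -mulrN opprB.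
exists (b * c), (l + d / 2); rewrite mulrA; split.
- by apply: contra_neq c0 => h; rewrite -!mulrA (mulrA a) h !mulr0.
- have -> : l + d / 2 - d / 2 = l by lra.
  by move: pc; rewrite [star (a * b * c)]star_mul sc !mulrA.
- have -> : l + d / 2 + d / 2 = l + d by lra.
  have := pos_conj c p2.
  by rewrite [star (a * b * c)]star_mul !mulrA.
Qed.

Lemma excise_sa a e (eps : R) : a != 0 -> sa e -> 0 < eps ->
  exists b (l : R), a * b != 0 /\
    forall s, unit_family (a * b) s -> nr (conj_sum s e - cst l) <= eps.
Proof.
move=> a0 se eps0.
have [k hk] : exists k, nr e / 2 ^+ k <= eps.
  have [k hk] : exists k : nat, nr e / eps < k%:R.
    exists (Num.bound (nr e / eps)); apply: archi_boundP.
    by rewrite divr_ge0 ?nr_ge0 ?ltW.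
  exists k; rewrite ler_pdivrMr ?exprn_gt0 //.
  have h2 : k%:R <= 2 ^+ k :> R by rewrite -natrX ler_nat ltnW // ltn_expl.
  move: hk; rewrite ltr_pdivrMr // => /ltW/le_trans; apply.
  by rewrite mulrC ler_pM2l.
have [b [l [ab0 p1 p2]]] := excise_bisect k a0 se (lexx _).
exists b, l; split=> // s us; apply: le_trans hk.
have s1 := us.2; set d := nr e / 2 ^+ k in p1 p2 *.
apply: nr_le_pos.
- by apply/saB/sa_cst; rewrite /sa conj_sum_star se.
- have := unit_family_pos us p2; rewrite conj_sumB conj_sum_cst //.
  by rewrite rmorphD scalerDl opprB addrA (addrC (cst d)).
- have := unit_family_pos us p1; rewrite conj_sumB conj_sum_cst //.
  by rewrite rmorphB scalerBl opprB addrCA.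
Qed.

Lemma excise a e (eps : R) : a != 0 -> 0 < eps ->
  exists b (l : R[i]), a * b != 0 /\
    forall s, unit_family (a * b) s -> nr (conj_sum s e - l *: 1) <= eps.
Proof.
move=> a0 eps0; have eps2 : 0 < eps / 2 by lra.
have [x [y [sx sy -> _]]] := sa_decomp e.
have [b [l [ab0 hb]]] := excise_sa a0 sx eps2.
have [c [m [abc0 hc]]] := excise_sa ab0 sy eps2.
exists (b * c), (l%:C + 'i * m%:C); rewrite mulrA; split=> // s us.
have hx := hb _ (unit_familyM us); have hy := hc _ us.
have -> : conj_sum s (x + 'i *: y) - (l%:C + 'i * m%:C) *: 1 =
    (conj_sum s x - cst l) + 'i *: (conj_sum s y - cst m).
  by rewrite conj_sumD conj_sumZ; nc.
apply: le_trans (nrD _ _) _; rewrite nrZ normCi mul1r.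
by lra.
Qed.

(** The elements are excised one after the other by further right factors; [unit_familyM] keeps the
    earlier estimates. *)
Lemma excise_seq (I : eqType) (r : seq I) (F : I -> E) a (eps : R) :
  a != 0 -> 0 < eps ->
  exists b (l : I -> R[i]), a * b != 0 /\ forall i s, i \in r ->
    unit_family (a * b) s -> nr (conj_sum s (F i) - l i *: 1) <= eps.
Proof.
move=> a0 eps0; elim: r => [|i r [b [l [ab0 hb]]]].
  by exists 1, (fun=> 0); rewrite mulr1.
have [c [m [abc0 hc]]] := excise (F i) ab0 eps0.
exists (b * c), (fun j => if j == i then m else l j); rewrite mulrA.
split=> // j s; rewrite inE; have [->|_] /= := eqVneq j i.
  by move=> _; exact: hc.
by move=> jr /unit_familyM; exact: hb.
Qed.

Lemma sa_parts_le u v : sa u -> sa v ->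
  nr u <= nr (u + 'i *: v) /\ nr v <= nr (u + 'i *: v).
Proof.
move=> su sv; have st : star (u + 'i *: v) = u - 'i *: v.
  by rewrite starD starZi su sv.
have h1 := nrD (u + 'i *: v) (star (u + 'i *: v)).
have h2 := nrB (u + 'i *: v) (star (u + 'i *: v)).
rewrite nr_star st in h1 h2.
have e1 : u + 'i *: v + (u - 'i *: v) = 2%:C *: u by nc.
have e2 : u + 'i *: v - (u - 'i *: v) = 2%:C *: ('i *: v) by nc.
rewrite e1 nrZr in h1; rewrite e2 nrZr nrZ normCi mul1r in h2.
by move: h1 h2; rewrite ger0_norm //; split; lra.
Qed.

(** The real or the imaginary part of [e] has norm at least [c], half the norm of [e]. It or its
    negative is not bounded above by [c / 2], and the positive part of the excess over [c / 2]
    serves as [b]. *)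
Lemma compress_lower_bound e : e != 0 -> exists2 b, b != 0 &
  forall s, unit_family b s -> nr e / 4 <= nr (conj_sum s e).
Proof.
move=> e0.
have main x (c : R) : 0 < c -> sa x -> c <= nr x -> exists2 b, b != 0 &
    forall s, unit_family b s -> c / 2 <= nr (conj_sum s x).
  move=> c0 sx xc.
  have dir y : sa y -> pos (cst (c / 2) - y) \/ exists2 b, b != 0 &
      forall s, unit_family b s -> c / 2 <= nr (conj_sum s y).
    move=> sy; have syc : sa (y - cst (c / 2)) by exact/saB/sa_cst.
    have [h|[b [sb pb b0]]] := pos_or_compress syc.
      by left; rewrite -opprB.
    right; exists b => [|s us].
      by apply: contra_neq b0 => ->; rewrite mulr0.
    apply: pos_nr_lb; first lra.
      by rewrite /sa conj_sum_star sy.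
    rewrite -(conj_sum_cst _ us.2) -conj_sumB; apply: (unit_family_pos us).
    by rewrite sb.
  have [h1|//] := dir x sx; have [h2|[b b0 hb]] := dir _ (saN sx).
    have := nr_le_pos sx h1; rewrite -[x in _ + x]opprK => /(_ h2).
    by lra.
  exists b => // s /hb; rewrite -scaleN1r conj_sumZ scaleN1r nrN; exact.
have [x [y [sx sy ee _]]] := sa_decomp e.
have ne := nr_gt0 e0.
have hsum : nr e <= nr x + nr y.
  by rewrite {1}ee (le_trans (nrD _ _)) // nrZ normCi mul1r.
have e2 : 0 < nr e / 2 by lra.
have hs s : conj_sum s e = conj_sum s x + 'i *: conj_sum s y.
  by rewrite ee conj_sumD conj_sumZ.
have hsa s z : sa z -> sa (conj_sum s z) by rewrite /sa conj_sum_star => ->.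
have [xb|xb] := leP (nr e / 2) (nr x).
  have [b b0 hb] := main x _ e2 sx xb; exists b => // s /hb.
  have [+ _] := sa_parts_le (hsa s _ sx) (hsa s _ sy).
  by rewrite -hs; lra.
have yb : nr e / 2 <= nr y by lra.
have [b b0 hb] := main y _ e2 sy yb; exists b => // s /hb.
have [_ +] := sa_parts_le (hsa s _ sx) (hsa s _ sy).
by rewrite -hs; lra.
Qed.

(** The closed ideal generated by [p = star a * a] contains 1, so some [g = \sum_t t.1 * p * t.2] is
    within 1/2 of 1. Expanding [\sum_t star (f t) * f t] shows that [\sum_t (t.1 * p * star t.1 +
    star t.2 * p * t.2)] has the form [1 + k] with [k] positive; conjugation by an inverse square
    root of [1 + k] turns it into 1. *)
Lemma simple_unit_family a : cstar_simple [set: E] -> a != 0 ->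
  exists s, unit_family a s.
Proof.
move=> simE a0; pose p := star a * a.
have p0 : p != 0.
  apply: contra_neq a0 => h.
  have : nr a ^+ 2 = 0 by rewrite -nr_cstar -/p h nr0.
  by move/eqP; rewrite expf_eq0 /= => /eqP/nr0_eq0.
pose S := [set x | exists l : seq (E * E), x = \sum_(t <- l) t.1 * p * t.2].
have SM d x : S x -> S (d * x) /\ S (x * d).
  move=> [l ->]; split.
    exists [seq (d * t.1, t.2) | t <- l].
    by rewrite big_map mulr_sumr; apply: eq_bigr => t _; rewrite /= !mulrA.
  exists [seq (t.1, t.2 * d) | t <- l].
  by rewrite big_map mulr_suml; apply: eq_bigr => t _; rewrite /= !mulrA.
have SD x y : S x -> S y -> S (x + y).
  by move=> [l ->] [m ->]; exists (l ++ m); rewrite big_cat.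
have cS : closed_ideal [set: E] (closure S).
  split=> //.
  - by apply: subset_closure; exists [::]; rewrite big_nil.
  - by move=> x y; apply: closure_add SD.
  - move=> c x; apply: closure_scale => z /(SM (c *: 1))[+ _].
    by rewrite -scalerAl mul1r.
  - split; last exact: closed_closure.
    move=> d x _ Sx; split.
      by apply: closure_mull Sx => z /(SM d)[+ _]; exact: subset_closure.
    by apply: closure_mulr Sx => z /(SM d)[_]; exact: subset_closure.
have Sp : closure S p.
  apply: subset_closure; exists [:: (1, 1)].
  by rewrite big_seq1 /= mul1r mulr1.
have [c0|cT] := simE _ cS.
  by move: Sp; rewrite c0 => /= ep; rewrite ep eqxx in p0.
have : closure S 1 by rewrite cT.
move/closureR => /(_ 2^-1 _)[|_ [l ->]]; first by rewrite invr_gt0.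
set g := \sum_(t <- l) _ => hg.
pose f (t : E * E) := a * star t.1 - a * t.2.
have pk : pos (1 - ((1 - g) + star (1 - g)) + \sum_(t <- l) star (f t) * f t).
  apply: posD; last by apply: pos_sum => t _; exact: pos_star.
  rewrite -[1](scale1r (1 : E)) -(rmorph1 (real_complex R)); apply: nr_cstB_pos.
    by rewrite /sa starD starK addrC.
  by rewrite (le_trans (nrD _ _)) // nr_star rmorph1 scale1r; lra.
have [r sr hr] := pos_inv_root pk.
have eS : 1 + (1 - ((1 - g) + star (1 - g)) + \sum_(t <- l) star (f t) * f t) =
    \sum_(t <- l) (t.1 * p * star t.1 + star t.2 * p * t.2).
  have -> : \sum_(t <- l) star (f t) * f t =
      \sum_(t <- l) (t.1 * p * star t.1 + star t.2 * p * t.2) - (g + star g).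
    rewrite /g star_sum -big_split -sumrB; apply: eq_bigr => t _ /=.
    rewrite /f /p starB !star_mul !starK; nc.
  by rewrite starB star1; nc.
exists ([seq a * (star t.1 * r) | t <- l] ++ [seq a * (t.2 * r) | t <- l]).
split.
  move=> x; rewrite mem_cat => /orP[] /mapP[t _ ->].
    by exists (star t.1 * r).
  by exists (t.2 * r).
rewrite -[RHS]hr eS /conj_sum big_cat /= !big_map -big_split /=.
rewrite mulr_sumr mulr_suml.
apply: eq_bigr => t _; rewrite !star_mul starK sr /p; nc.
Qed.

End Excision.

(** * Tensor products of Hilbert spaces *)

Section HilbertSpaces.
Variables (R : realType) (H : hilbertType R).
Implicit Types h k : H.

Lemma innerDl h h' k : inner (h + h') k = inner h k + inner h' k.
Proof. exact: linearDl. Qed.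

Lemma innerZl (c : R[i]) h k : inner (c *: h) k = c * inner h k.
Proof. exact: linearZl_LR. Qed.

Lemma innerC h k : inner h k = Num.conj (inner k h).
Proof. by rewrite (hermC inner) expr0 mul1r. Qed.

Lemma innerZr (c : R[i]) h k : inner h (c *: k) = Num.conj c * inner h k.
Proof. by rewrite innerC innerZl rmorphM /= -innerC. Qed.

Lemma inner0l k : inner 0 k = 0.
Proof. by rewrite -(scale0r (0 : H)) innerZl mul0r. Qed.

Lemma inner0r h : inner h 0 = 0.
Proof. by rewrite innerC inner0l rmorph0. Qed.

Lemma innerBl h h' k : inner (h - h') k = inner h k - inner h' k.
Proof. by rewrite innerDl -scaleN1r innerZl mulN1r. Qed.

Lemma innerBr h k k' : inner h (k - k') = inner h k - inner h k'.
Proof. by rewrite innerC innerBl rmorphB /= -!innerC. Qed.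

Lemma inner_sum_l (I : Type) (s : seq I) (F : I -> H) k :
  inner (\sum_(i <- s) F i) k = \sum_(i <- s) inner (F i) k.
Proof.
elim: s => [|i s IH]; first by rewrite !big_nil inner0l.
by rewrite !big_cons innerDl IH.
Qed.

Lemma inner_sum_r (I : Type) (s : seq I) (F : I -> H) h :
  inner h (\sum_(i <- s) F i) = \sum_(i <- s) inner h (F i).
Proof.
rewrite innerC inner_sum_l rmorph_sum; apply: eq_bigr => i _ /=.
by rewrite -innerC.
Qed.

Lemma inner_self h : inner h h = (nr h ^+ 2)%:C.
Proof. by rewrite -inner_norm nrE rmorphXn. Qed.

Lemma inner_self_ge0 h : 0 <= inner h h.
Proof. by rewrite inner_self -(rmorph0 (real_complex R)) lecR sqr_ge0. Qed.

Definition cabs (z : R[i]) : R := complex.Re `|z|.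

Lemma cabsE z : `|z| = (cabs z)%:C.
Proof. by rewrite /cabs RRe_real ?normr_real. Qed.

Lemma cauchy_schwarz h k : cabs (inner h k) <= nr h * nr k.
Proof.
have [->|k0] := eqVneq k 0.
  by rewrite inner0r nr0 mulr0 /cabs normr0.
have nk := nr_gt0 k0.
pose a := inner k k; pose d := inner h k.
have := inner_self_ge0 (a *: h - d *: k).
have ea : Num.conj a = a by rewrite /a -innerC.
have ed : inner k h = Num.conj d by rewrite innerC.
have -> : inner (a *: h - d *: k) (a *: h - d *: k) =
    a * (a * inner h h - d * Num.conj d).
  rewrite innerBl !innerBr !innerZl !innerZr ea ed -/a -/d; ring.
rewrite -normCK cabsE /a !inner_self -!rmorphXn -!rmorphM -rmorphB -rmorphM.
rewrite -(rmorph0 (real_complex R)) lecR pmulr_rge0 ?exprn_gt0 // subr_ge0.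
move=> hle; rewrite -(@ler_pXn2r _ 2) ?nnegrE ?mulr_ge0 ?nr_ge0 //.
  by rewrite exprMn mulrC.
by rewrite -lecR rmorph0 -cabsE.
Qed.

End HilbertSpaces.

Section TensorForm.
Variables (R : realType) (H K : hilbertType R).
Implicit Types s t : seq (H * K).

Definition tensor_form s t : R[i] :=
  \sum_(p <- s) \sum_(q <- t) inner p.1 q.1 * inner p.2 q.2.

Lemma tensor_formC s t : tensor_form s t = Num.conj (tensor_form t s).
Proof.
rewrite /tensor_form exchange_big rmorph_sum; apply: eq_bigr => p _.
rewrite rmorph_sum; apply: eq_bigr => q _.
by rewrite rmorphM /= -!innerC.
Qed.

Lemma tensor_form_catl s s' t :
  tensor_form (s ++ s') t = tensor_form s t + tensor_form s' t.
Proof. by rewrite /tensor_form big_cat. Qed.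

Lemma tensor_form_catr s t t' :
  tensor_form s (t ++ t') = tensor_form s t + tensor_form s t'.
Proof. by rewrite tensor_formC tensor_form_catl rmorphD /= -!tensor_formC. Qed.

(** The Gram matrix of the second components is kept, and the first components
    are orthogonalised one at a time. *)
Lemma tensor_form_ge0 s : 0 <= tensor_form s s.
Proof.
have [n] := ubnP (size s); elim: n s => // n IH [_|p s].
  by rewrite /tensor_form big_nil.
rewrite /= ltnS => hs.
have head0 t (h : K) :
    tensor_form ((0, h) :: t) ((0, h) :: t) = tensor_form t t.
  rewrite -cat1s tensor_form_catl !tensor_form_catr.
  have h0 t' : tensor_form [:: (0, h)] t' = 0.
    rewrite /tensor_form big_seq1; apply: big1 => q _.
    by rewrite /= inner0l mul0r.
  by rewrite !h0 (tensor_formC t) h0 rmorph0 !add0r.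
case: p => p1 p2; have [->|p0] := eqVneq p1 0.
  by rewrite head0; exact: IH.
pose N := inner p1 p1; pose c (q : H * K) := inner q.1 p1 / N.
have N0 : N != 0.
  rewrite /N inner_self; apply: contra_neq p0 => /eqP.
  rewrite -(rmorph0 (real_complex R)) (inj_eq (@complexI R)) expf_eq0 /=.
  by move=> /eqP/nr0_eq0.
have cN : Num.conj N = N by rewrite /N -innerC.
pose g (q : H * K) := (q.1 - c q *: p1, q.2).
(* The component along [p1] is split off from every first entry; it contributes [N] times an inner
   product in [K], and in what remains the head has first entry 0 and drops out. *)
have split_form t t' : tensor_form t t' =
    N * inner (\sum_(q <- t) c q *: q.2) (\sum_(r <- t') c r *: r.2)
    + tensor_form (map g t) (map g t').
  rewrite inner_sum_l mulr_sumr /tensor_form big_map -big_split.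
  apply: eq_bigr => q _ /=.
  rewrite inner_sum_r mulr_sumr big_map -big_split.
  apply: eq_bigr => r _ /=.
  rewrite innerBl !innerBr !innerZl !innerZr /c -/N.
  rewrite [inner p1 r.1]innerC rmorphM fmorphV /= cN.
  by field.
have gp : g (p1, p2) = (0, p2) by rewrite /g /c /= divff // scale1r subrr.
rewrite split_form map_cons gp head0; apply: addr_ge0.
  by apply: mulr_ge0; exact: inner_self_ge0.
by apply: IH; rewrite size_map.
Qed.

Lemma hnorm_sqr s : hnorm s ^+ 2 = tensor_form s s.
Proof. exact: sqrtCK. Qed.

Lemma hnorm_ge0 s : 0 <= hnorm s.
Proof. by rewrite sqrtC_ge0; exact: tensor_form_ge0. Qed.

End TensorForm.

(** * Norm bounds for representations *)

Section Representations.
Variables (R : realType) (A : cstarAlgType R) (H : hilbertType R).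
Variable rho : representation A H.

(** Writing the square of the norm of [a] as [star a * a + w^2] with [w] self-adjoint, the
    difference of the two squared sides is the squared norm of [rho w h]. *)
Lemma rep_nr_le a h : nr (rho a h) <= nr a * nr h.
Proof.
rewrite -(@ler_pXn2r _ 2) ?nnegrE ?mulr_ge0 ?nr_ge0 //.
have sq : inner (rho a h) (rho a h) = inner (rho (star a * a) h) h.
  by rewrite repM rep_star.
have sa_sq : sa (star a * a) by rewrite /sa star_mul starK.
have [w [/pos_sa sw ww _]] := root_cstB sa_sq (lexx _).
have e : star a * a = (nr (star a * a))%:C *: 1 - w * w.
  by rewrite ww opprB addrC subrK.
rewrite -lecR -inner_self sq e repD repZ rep1 -scaleN1r repZ scaleN1r repM.
rewrite innerBl innerZl -{1}sw rep_star nr_cstar exprMn.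
rewrite [X in _ <= X](rmorphM (real_complex R)) /= -(inner_self h).
by rewrite lerBlDr lerDl inner_self_ge0.
Qed.

Lemma rep_coef_le a h k : cabs (inner (rho a h) k) <= nr h * nr k * nr a.
Proof.
apply: le_trans (cauchy_schwarz _ _) _.
by rewrite mulrAC ler_wpM2r ?nr_ge0 // mulrC rep_nr_le.
Qed.

End Representations.

(** * The minimal tensor product *)

Section SimpleKernel.
Variables (R : realType) (A T : cstarAlgType R) (f : A -> T).
Hypothesis hf : unital_star_hom f.

Lemma simple_hom_inj : cstar_simple [set: A] -> forall x, f x = 0 -> x = 0.
Proof.
have [hD hZ hM hs h1] := hf.
have f0 : f 0 = 0 by rewrite -(subrr (0 : A)) (homB hf) subrr.
move=> simA; have [] := simA [set x | f x = 0].
- split=> //=.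
  + by move=> x y hx hy; rewrite hD hx hy addr0.
  + by move=> c x hx; rewrite hZ hx scaler0.
  + split; first by move=> d x _ hx; rewrite !hM hx mulr0 mul0r.
    apply/closedR => x h; apply: (@nr_small _ _ 1) => e /h[b b0 hb].
    have b0' : f b = 0 by [].
    rewrite mul1r -(subr0 (f x)) -b0' -(homB hf).
    by rewrite (le_trans (hom_nr_le hf _)) // ltW.
- by move=> k0 x fx; have : [set x | f x = 0] x by []; rewrite k0.
- move=> kT; have : [set x | f x = 0] 1 by rewrite kT.
  by rewrite /= h1 => /eqP; rewrite oner_eq0.
Qed.

End SimpleKernel.

Section MinTensor.
Variables (R : realType) (E A : cstarAlgType R) (T : minTensor E A).
Implicit Types (u v : seq (E * A)) (x y : T).

Definition ten u : T := \sum_(p <- u) tens T p.1 p.2.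

Lemma hom_tensl : unital_star_hom (fun e => tens T e 1).
Proof.
split=> [e e'|c e|e e'|e|]; [exact: tensDl|exact: tensZl| | |exact: tens1].
  by rewrite tensM mulr1.
by rewrite tens_star star1.
Qed.

Lemma hom_tensr : unital_star_hom (tens T 1).
Proof.
split=> [c c'|l c|c c'|c|]; [exact: tensDr|exact: tensZr| | |exact: tens1].
  by rewrite tensM mulr1.
by rewrite tens_star star1.
Qed.

Lemma tensE e c : tens T e c = tens T e 1 * tens T 1 c.
Proof. by rewrite tensM mulr1 mul1r. Qed.

Lemma tens_nr_le e c : nr (tens T e c) <= nr e * nr c.
Proof.
rewrite tensE (le_trans (nrM _ _)) // ler_pM ?nr_ge0 //.
  exact: (hom_nr_le hom_tensl).
exact: (hom_nr_le hom_tensr).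
Qed.

Lemma ten_approx x (e : R) : 0 < e -> exists u, nr (x - ten u) < e.
Proof.
move=> e0; pose B := ball x e%:C.
have B0 : B^° x by apply/nbhsR; exists e => // y; rewrite /B ballR.
have [|y [/interior_subset By [u yu]]] :=
  @tens_dense _ _ _ T _ _ (@open_interior _ B).
  by exists x.
by exists u; rewrite /ten -yu; move: By; rewrite /B ballR.
Qed.

Definition oppl u := [seq (- p.1, p.2) | p <- u].

Lemma ten_sub u v : ten (u ++ oppl v) = ten u - ten v.
Proof.
rewrite /ten big_cat /= big_map -sumrN; congr (_ + _); apply: eq_bigr => p _ /=.
by rewrite -scaleN1r tensZl scaleN1r.
Qed.

Section Spatial.
Variables (H K : hilbertType R).
Variables (pi : representation E H) (rho : representation A K).

(** Matrix coefficients of [u] are matrix coefficients in [H] of slices of [u] by vector functionals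
    of [rho]; this is how the spatial norm gives access to slices. *)
Lemma rep_tensor_form u s t :
  tensor_form (rep_tensor pi rho u s) t =
  \sum_(q <- s) \sum_(r <- t)
    inner (pi (\sum_(p <- u) inner (rho p.2 q.2) r.2 *: p.1) q.1) r.1.
Proof.
rewrite /tensor_form /rep_tensor big_allpairs_dep exchange_big /=.
apply: eq_bigr => q _; rewrite exchange_big /=; apply: eq_bigr => r _.
elim: u => [|p u IH].
  by rewrite !big_nil -(scale0r (0 : E)) repZ scale0r inner0l.
by rewrite !big_cons repD innerDl repZ innerZl -IH mulrC.
Qed.

Lemma rep_tensor_sub u v s :
  let a := rep_tensor pi rho u s in let b := rep_tensor pi rho v s in
  let d := rep_tensor pi rho (u ++ oppl v) s in
  tensor_form d d = tensor_form a a + tensor_form b b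
    - tensor_form b a - Num.conj (tensor_form b a).
Proof.
move=> a b d; pose b' := rep_tensor pi rho (oppl v) s.
have dE : d = a ++ b' by rewrite /d /rep_tensor allpairs_cat.
have b'E t : tensor_form b' t = - tensor_form b t.
  rewrite !rep_tensor_form -sumrN; apply: eq_bigr => q _.
  rewrite -sumrN; apply: eq_bigr => r _.
  rewrite big_map /=; under eq_bigr do rewrite scalerN.
  by rewrite sumrN -scaleN1r repZ innerZl mulN1r.
have b'Er t : tensor_form t b' = - tensor_form t b.
  by rewrite tensor_formC b'E rmorphN /= -tensor_formC.
rewrite dE tensor_form_catl !tensor_form_catr !b'Er !b'E (tensor_formC a b).
ring.
Qed.

Lemma spatial_le u s : hnorm s <= 1 ->
  tensor_form (rep_tensor pi rho u s) (rep_tensor pi rho u s)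
    <= (nr (ten u) ^+ 2)%:C.
Proof.
move=> s1; rewrite -hnorm_sqr rmorphXn /=.
rewrite ler_pXn2r ?nnegrE ?hnorm_ge0 -?nrE ?normr_ge0 //.
by have [ub _] := tens_norm T u; apply: ub; exists H, K, pi, rho, s.
Qed.

End Spatial.

Lemma spatial_attained u (r : R) : 0 <= r -> r < nr (ten u) ->
  exists (H K : hilbertType R) (pi : representation E H)
    (rho : representation A K) (s : seq (H * K)),
  hnorm s <= 1 /\
  (r ^+ 2)%:C < tensor_form (rep_tensor pi rho u s) (rep_tensor pi rho u s).
Proof.
move=> r0 ru; apply: contrapT => hn.
have [_ /(_ r%:C)] := tens_norm T u.
suff ub : ubound (spatial_values u) r%:C.
  by move=> /(_ ub); rewrite nrE lecR leNgt ru.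
move=> _ [H [K [pi [rho [s [s1 ->]]]]]].
have h0 := hnorm_ge0 (rep_tensor pi rho u s).
rewrite real_leNgt ?ger0_real ?lecR //.
apply/negP => h; apply: hn; exists H, K, pi, rho, s; split=> //.
rewrite -hnorm_sqr rmorphXn /= ltr_pXn2r // nnegrE ?lecR //.
Qed.

(** Slices are taken of finite sums only, so the slice of an approximant [ten u] must outweigh the
    approximation error, scaled by the bound [M] of [psi] and by [C]. If all vector functionals
    failed this, a matrix coefficient known to be large would be small. *)
Lemma slice_nonzero x (C : R) : x != 0 -> 0 <= C ->
  exists (u : seq (E * A)) (psi : A -> R[i]) (M : R),
  [/\ {morph psi : a b / a + b}, forall c a, psi (c *: a) = c * psi a,
      0 <= M, forall a, cabs (psi a) <= M * nr a &
      C * M * nr (x - ten u) < nr (\sum_(p <- u) psi p.2 *: p.1)].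
Proof.
move=> x0 C0; pose d := nr x / 8.
have d0 : 0 < d by rewrite divr_gt0 // nr_gt0.
have nx : nr x = 8 * d by rewrite /d; field.
clearbody d; have d2 : 0 <= 2 * d by lra.
have [u0 hu0] := ten_approx x d0.
have hn : 6 * d < nr (ten u0).
  by have := nr_leB x (ten u0); lra.
have [|H [K [pi [rho [s [s1 hs]]]]]] := spatial_attained _ hn; first lra.
set t := rep_tensor pi rho u0 s in hs.
pose W := \sum_(q <- s) \sum_(r <- t) nr q.1 * nr r.1 * (nr q.2 * nr r.2).
have W0 : 0 <= W.
  by apply: sumr_ge0 => q _; apply: sumr_ge0 => r _; rewrite !mulr_ge0 ?nr_ge0.
(* The vectors [s] and [t] come from the coarse approximant [u0]; the finer one [v] is chosen
   afterwards, with a precision depending on their size [W]. *)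
pose eta := Num.min d (d ^+ 2 / (C * W + 1)).
have CW0 : 0 < C * W + 1 by rewrite ltr_wpDl // mulr_ge0.
have eta0 : 0 < eta by rewrite lt_min d0 divr_gt0 // exprn_gt0.
have [v hv] := ten_approx x eta0.
have [hv1 hv2] : nr (x - ten v) < d /\ nr (x - ten v) * (C * W + 1) < d ^+ 2.
  by move: hv; rewrite lt_min => /andP[-> h]; split; rewrite // -ltr_pdivlMr.
set w := rep_tensor pi rho v s.
(* The vectors satisfy [|t|^2 > 36 d^2] and [|t - w|^2 <= 4 d^2], so twice the real part of the
   cross term is at least [32 d^2]. *)
have low : 16 * d ^+ 2 <= complex.Re (tensor_form w t).
  have := spatial_le pi rho (u0 ++ oppl v) s1; rewrite rep_tensor_sub -/t -/w.
  have duv : nr (ten (u0 ++ oppl v)) ^+ 2 <= (2 * d) ^+ 2.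
    rewrite ten_sub ler_pXn2r ?nnegrE ?nr_ge0 //.
    have := nr_dist (ten u0) x (ten v); rewrite (nrC (ten u0) x); lra.
  have := tensor_form_ge0 w; move: hs.
  move: (tensor_form t t) (tensor_form w w) (tensor_form w t).
  move=> [a a'] [b b'] [c c'].
  rewrite !lecE ltcE /= => /andP[_ h1] /andP[_ h2] /andP[_ h3].
  lra.
apply: contrapT => hneg.
have each q r :
    cabs (inner (pi (\sum_(p <- v) inner (rho p.2 q.2) r.2 *: p.1) q.1) r.1)
    <= nr q.1 * nr r.1 * (nr q.2 * nr r.2) * (C * nr (x - ten v)).
  apply: le_trans (rep_coef_le _ _ _ _) _.
  rewrite -[X in _ <= X]mulrA ler_wpM2l ?mulr_ge0 ?nr_ge0 //.
  rewrite mulrA (mulrC _ C).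
  rewrite leNgt; apply/negP => h; apply: hneg.
  exists v, (fun a => inner (rho a q.2) r.2), (nr q.2 * nr r.2); split.
  - by move=> a b; rewrite repD innerDl.
  - by move=> c a; rewrite repZ innerZl.
  - by rewrite mulr_ge0 ?nr_ge0.
  - by move=> a; exact: rep_coef_le.
  - exact: h.
have Re_cabs (z : R[i]) : complex.Re z <= cabs z.
  have := normc_ge_Re z; rewrite cabsE lecR.
  by apply: le_trans; exact: ler_norm.
have : complex.Re (tensor_form w t) <= W * (C * nr (x - ten v)).
  rewrite rep_tensor_form /W mulr_suml.
  have Re_sum (I : Type) (l : seq I) (F : I -> R[i]) :
    complex.Re (\sum_(i <- l) F i) = \sum_(i <- l) complex.Re (F i).
    elim: l => [|i l IH]; first by rewrite !big_nil.
    by rewrite !big_cons -IH; case: (F i) (\sum_(_ <- _) _) => ? ? [].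
  rewrite Re_sum; apply: ler_sum => q _; rewrite Re_sum mulr_suml.
  by apply: ler_sum => r _; apply: (le_trans (Re_cabs _)); exact: each.
have := nr_ge0 (x - ten v).
have := exprn_gt0 2 d0.
move: low hv2; move: (nr (x - ten v)) (complex.Re _) => y z; nra.
Qed.

End MinTensor.

(** * Compressions of the first factor *)

Section Compression.
Variables (R : realType) (E A : cstarAlgType R) (T : minTensor E A).
Hypothesis simA : cstar_simple [set: A].
Implicit Types (a b e : E) (s : seq E) (u : seq (E * A)) (x y : T).

(** Simplicity of [A] makes this homomorphism injective, hence isometric, so Cauchy sequences and
    closed sets can be pulled back from [T] to [A]. *)
Lemma tensr_nr c : nr (tens T 1 c) = nr c.
Proof.
apply: (hom_isometric (hom_tensr T)).
exact: (simple_hom_inj (hom_tensr T) simA).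
Qed.

Lemma tensrB c c' : tens T 1 (c - c') = tens T 1 c - tens T 1 c'.
Proof. exact: (homB (hom_tensr T)). Qed.

Definition compress s x : T := conj_sum [seq tens T e 1 | e <- s] x.

Lemma compressB s x y : compress s (x - y) = compress s x - compress s y.
Proof. exact: conj_sumB. Qed.

Lemma compress_tens s e c : compress s (tens T e c) = tens T (conj_sum s e) c.
Proof.
rewrite /compress /conj_sum big_map.
rewrite [RHS]tensE (hom_sum (hom_tensl T)) mulr_suml.
apply: eq_bigr => a _; rewrite tens_star star1 !tensM.
by rewrite !mulr1 !mul1r.
Qed.

Lemma compress_le s x : conj_sum s 1 = 1 -> nr (compress s x) <= 2 * nr x.
Proof.
move=> s1; apply: conj_sum_le.
by rewrite -[LHS]/(compress s 1) -(tens1 T) compress_tens s1.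
Qed.

Lemma compress_ten s u (l : E * A -> R[i]) (eps : R) :
  (forall p, p \in u -> nr (conj_sum s p.1 - l p *: 1) <= eps) ->
  nr (compress s (ten T u) - tens T 1 (\sum_(p <- u) l p *: p.2))
    <= eps * \sum_(p <- u) nr p.2.
Proof.
move=> h.
have -> : compress s (ten T u) - tens T 1 (\sum_(p <- u) l p *: p.2) =
    \sum_(p <- u) tens T (conj_sum s p.1 - l p *: 1) p.2.
  rewrite /ten (hom_sum (hom_tensr T)) /=.
  have -> : compress s (\sum_(p <- u) tens T p.1 p.2) =
      \sum_(p <- u) tens T (conj_sum s p.1) p.2.
    rewrite /compress /conj_sum; under eq_bigr do rewrite mulr_sumr mulr_suml.
    rewrite exchange_big; apply: eq_bigr => p _.
    exact: (compress_tens s p.1 p.2).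
  rewrite -sumrB; apply: eq_bigr => p _.
  by rewrite tensDl -scaleNr tensZl tensZr scaleNr.
apply: le_trans (nr_sum _ _) _; rewrite mulr_sumr big_seq [X in _ <= X]big_seq.
apply: ler_sum => p pu; apply: le_trans (tens_nr_le _ _ _) _.
by rewrite ler_wpM2r ?nr_ge0 // h.
Qed.

Lemma compress_approx x a (eps : R) : a != 0 -> 0 < eps ->
  exists b c, a * b != 0 /\ forall s, unit_family (a * b) s ->
    nr (compress s x - tens T 1 c) <= eps.
Proof.
(* Compression at most doubles the error [eps / 4]; the other half of [eps] is left for the excision
   of the first factors of [u]. *)
move=> a0 eps0; have e4 : 0 < eps / 4 by lra.
have [u hu] := ten_approx x e4.
pose C := \sum_(p <- u) nr p.2.
have C0 : 0 <= C by apply: sumr_ge0 => p _; exact: nr_ge0.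
have d0 : 0 < eps / (2 * (C + 1)) by rewrite divr_gt0 // mulr_gt0 // ltr_wpDl.
have [b [l [ab0 hb]]] := excise_seq u fst a0 d0.
exists b, (\sum_(p <- u) l p *: p.2); split=> // s us.
have := compress_ten (fun p pu => hb p s pu us).
have := compress_le (x - ten T u) us.2; rewrite compressB.
have := nr_dist (compress s x) (compress s (ten T u))
  (tens T 1 (\sum_(p <- u) l p *: p.2)).
have : eps / (2 * (C + 1)) * C <= eps / 2.
  by rewrite mulrAC ler_pdivrMr ?mulr_gt0 ?ltr_wpDl //; nra.
rewrite -/C; lra.
Qed.

(** Let [e] be the slice of [ten u] by [psi]. Excision brings [compress s x] near [1 (x) c] and
    [conj_sum s e] near [psi c], while [conj_sum s e] keeps a quarter of the norm of [e]. The
    errors, multiplied by [M], use up at most 1/8 and 1/16 of that norm, which leaves 1/16. *)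
Lemma compress_lower x : x != 0 ->
  exists a (k : R), [/\ a != 0, 0 < k &
    forall s, unit_family a s -> k <= nr (compress s x)].
Proof.
move=> x0; have C16 : (0 : R) <= 16 by lra.
have [u [psi [M [psiD psiZ M0 psi_le]]]] := slice_nonzero x0 C16.
set e := \sum_(p <- u) _ => he.
have e0 : e != 0.
  apply: contraTneq he => ->; rewrite nr0 -leNgt.
  by rewrite !mulr_ge0 ?nr_ge0.
have ne := nr_gt0 e0.
have [a a0 ha] := compress_lower_bound e0.
pose C := \sum_(p <- u) nr p.2.
have C0 : 0 <= C by apply: sumr_ge0 => p _; exact: nr_ge0.
have MC0 : 0 <= M * C by exact: mulr_ge0.
pose eps := nr e / (32 * (M * C + 1)).
have eps0 : 0 < eps by rewrite divr_gt0 // mulr_gt0 // ltr_wpDl.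
have heps : eps * (32 * (M * C + 1)) = nr e.
  by rewrite divfK // mulf_neq0 // lt0r_neq0 // ltr_wpDl.
have [b [l [ab0 hb]]] := excise_seq u fst a0 eps0.
exists (a * b), (nr e / (16 * (M + 1))); split=> // [|s us].
  by rewrite divr_gt0 // mulr_gt0 // ltr_wpDl.
pose c := \sum_(p <- u) l p *: p.2.
have h1 := compress_ten (fun p pu => hb p s pu us); rewrite -/C -/c in h1.
have h2 := compress_le (x - ten T u) us.2; rewrite compressB in h2.
have h3 : nr c <= nr (compress s x) + 2 * nr (x - ten T u) + eps * C.
  rewrite -tensr_nr.
  have := nr_leB (tens T 1 c) (compress s x).
  have := nr_dist (tens T 1 c) (compress s (ten T u)) (compress s x).
  by rewrite (nrC (tens T 1 c) (compress s (ten T u)))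
    (nrC (compress s (ten T u)) (compress s x)); lra.
have psi0 : psi 0 = 0 by rewrite -(scale0r (0 : A)) psiZ mul0r.
have psiS (F : E * A -> A) : psi (\sum_(p <- u) F p) = \sum_(p <- u) psi (F p).
  by elim: (u) => [|p v IH]; rewrite ?big_nil // !big_cons psiD IH.
have h4 : nr (conj_sum s e - psi c *: 1) <= M * C * eps.
  have -> : conj_sum s e - psi c *: 1 =
      \sum_(p <- u) psi p.2 *: (conj_sum s p.1 - l p *: 1).
    rewrite /e /c psiS scaler_suml.
    under [X in _ - X]eq_bigr do rewrite psiZ mulrC -scalerA.
    have -> : conj_sum s (\sum_(p <- u) psi p.2 *: p.1) =
        \sum_(p <- u) psi p.2 *: conj_sum s p.1.
      elim: (u) => [|p v IH]; last by rewrite !big_cons conj_sumD conj_sumZ IH.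
      by rewrite !big_nil /conj_sum; apply: big1 => z _; rewrite mulr0 mul0r.
    by rewrite -sumrB; apply: eq_bigr => p _; rewrite scalerBr.
  apply: le_trans (nr_sum _ _) _.
  rewrite /C mulr_sumr mulr_suml big_seq [X in _ <= X]big_seq.
  apply: ler_sum => p pu; rewrite nrZ ler_pM ?nr_ge0 //; [| |exact: hb].
    exact: nr_ge0 (psi p.2 : R[i]^o).
  exact: psi_le.
have h5 : nr (psi c *: (1 : E)) <= M * nr c.
  by rewrite nrZ nr1 mulr1; exact: psi_le.
have h6 := ha _ (unit_familyM us).
have h7 := nr_leB (conj_sum s e) (psi c *: 1).
have D0 : 0 < 16 * (M + 1) by lra.
rewrite ler_pdivrMr //.
have h8 : M * nr c <= M * (nr (compress s x) + 2 * nr (x - ten T u) + eps * C).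
  by rewrite ler_wpM2l.
have := nr_ge0 (compress s x).
clearbody eps; lra.
Qed.

(** Along the successive products [a n], a family for a late product compresses [x] close to
    [1 (x) c m] for all earlier [m] at once, so the [c m] form a Cauchy sequence. *)
Lemma compress_limit x : cstar_simple [set: E] -> x != 0 ->
  exists2 c : A, c != 0 & forall eps : R, 0 < eps ->
    exists s, nr (tens T 1 c - compress s x) < eps.
Proof.
move=> simE x0; have [a0 [k [a0n k0 hk]]] := compress_lower x0.
(* The choice is made for all pairs; where the second entry is 0 the requirement is vacuous and
   [(0, 0)] is a filler. *)
have /choice[g hg] : forall p : nat * E, exists q : E * A, p.2 != 0 ->
    p.2 * q.1 != 0 /\ forall s, unit_family (p.2 * q.1) s ->
      nr (compress s x - tens T 1 q.2) <= p.1.+1%:R^-1.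
  move=> [n a] /=; have [->|an] := eqVneq a 0.
    by exists (0, 0).
  have n0 : 0 < n.+1%:R^-1 :> R by rewrite invr_gt0.
  by have [b [c hbc]] := compress_approx x an n0; exists (b, c).
pose a := fix a n := if n is n.+1 then a n * (g (n, a n)).1 else a0.
have an n : a n != 0 by elim: n => //= n IH; have [] := hg (n, a n) IH.
pose c n := (g (n, a n)).2.
have step n s : unit_family (a n.+1) s ->
    nr (compress s x - tens T 1 (c n)) <= n.+1%:R^-1.
  by have [_ h] := hg (n, a n) (an n); exact: h.
have mono m n s : (m <= n)%N -> unit_family (a n) s -> unit_family (a m) s.
  by move/subnK <-; elim: (n - m)%N => //= i IH /unit_familyM.
have /choice[f hf] : forall n, exists s, unit_family (a n.+1) s.
  by move=> n; exact: simple_unit_family (an _).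
have tail (eps : R) : 0 < eps ->
    exists N, forall m n, (N <= m)%N -> (m <= n)%N ->
    nr (compress (f n) x - tens T 1 (c m)) <= eps.
  move=> eps0; exists (Num.bound eps^-1) => m n Nm mn.
  have us : unit_family (a m.+1) (f n) by apply: mono (hf n); rewrite ltnS.
  apply: le_trans (step _ _ us) _.
  rewrite -[eps]invrK lef_pV2 ?posrE ?invr_gt0 //.
  apply/ltW/(lt_le_trans (archi_boundP _)); first by rewrite invr_ge0 ltW.
  by rewrite ler_nat; apply: leq_trans Nm _.
have [cl hcl] : exists l, forall e : R, 0 < e ->
    exists N, forall n, (N <= n)%N ->
    nr (l - c n) <= e.
  apply: nr_complete => e e0; have e2 : 0 < e / 2 by lra.
  have [N hN] := tail _ e2; exists N => m n Nm Nn.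
  rewrite -tensr_nr tensrB.
  (* A family for the later of the two indices serves both [c m] and [c n]. *)
  apply: le_trans (nr_dist _ (compress (f (maxn m n)) x) _) _.
  rewrite nrC; have := hN _ _ Nm (leq_maxl m n).
  by have := hN _ _ Nn (leq_maxr m n); lra.
have lim (e : R) : 0 < e -> exists n, nr (tens T 1 cl - compress (f n) x) <= e.
  move=> e0; have e2 : 0 < e / 2 by lra.
  have [N hN] := tail _ e2; have [N' hN'] := hcl _ e2.
  exists (maxn N N').
  apply: le_trans (nr_dist _ (tens T 1 (c (maxn N N'))) _) _.
  rewrite -tensrB tensr_nr (nrC (tens T 1 _)).
  have := hN' _ (leq_maxr N N').
  by have := hN _ _ (leq_maxl N N') (leqnn _); lra.
exists cl => [|e e0].
  (* All these families are families for [a0], so the compressions stay at norm at least [k] and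
     cannot tend to 0. *)
  have k2 : 0 < k / 2 by lra.
  have [n hn] := lim _ k2; apply/eqP => c0.
  have z : tens T 1 0 = 0 by rewrite -(subrr (0 : A)) tensrB subrr.
  move: hn; rewrite c0 z sub0r nrN => hn.
  have := hk _ (mono _ _ _ (leq0n _) (hf n)); lra.
have e2 : 0 < e / 2 by lra.
by have [n hn] := lim _ e2; exists (f n); lra.
Qed.

End Compression.

(** * Intermediate algebras of the tensor product *)

Lemma closure_subalgebra (R : realType) (A : cstarAlgType R) (S : set A) :
  S 1 -> (forall x y, S x -> S y -> S (x + y)) ->
  (forall (c : R[i]) x, S x -> S (c *: x)) ->
  (forall x y, S x -> S y -> S (x * y)) -> (forall x, S x -> S (star x)) ->
  cstar_subalgebra (closure S).
Proof.
move=> S1 SD SZ SM Ss; split.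
- exact: subset_closure.
- by move=> x y; exact: closure_add.
- by move=> c x; apply: closure_scale => y; exact: SZ.
- by move=> x y; exact: closure_mul.
- by split; [move=> x; exact: closure_star | exact: closed_closure].
Qed.

Lemma tensor_sub_subalgebra (R : realType) (E A : cstarAlgType R)
    (T : minTensor E A) (B : set A) :
  cstar_subalgebra B -> cstar_subalgebra (tensor_sub (T := T) B).
Proof.
move=> [B1 BD BZ BM [Bs _]]; apply: closure_subalgebra.
- exists [:: (1, 1)]; last by rewrite big_seq1 tens1.
  by move=> p; rewrite inE => /eqP ->.
- move=> x y [u hu ->] [v hv ->]; exists (u ++ v); last by rewrite big_cat.
  by move=> p; rewrite mem_cat => /orP[/hu|/hv].
- move=> c x [u hu ->]; exists [seq (c *: p.1, p.2) | p <- u].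
    by move=> _ /mapP[p /hu hp ->].
  by rewrite big_map scaler_sumr; apply: eq_bigr => p _; rewrite tensZl.
- move=> x y [u hu ->] [v hv ->].
  exists [seq (p.1 * q.1, p.2 * q.2) | p <- u, q <- v].
    by move=> _ /allpairsP[[p q] [/hu hp /hv hq ->]]; exact: BM.
  rewrite big_allpairs_dep mulr_suml; apply: eq_bigr => p _.
  by rewrite mulr_sumr; apply: eq_bigr => q _; rewrite tensM.
- move=> x [u hu ->]; exists [seq (star p.1, star p.2) | p <- u].
    by move=> _ /mapP[p /hu hp ->]; exact: Bs.
  by rewrite big_map star_sum; apply: eq_bigr => p _; rewrite tens_star.
Qed.

Theorem theorem7p1 (R : realType) (A E : cstarAlgType R) (B : set A)
    (EA : minTensor E A) :
  cstar_irreducible B ->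
  cstar_simple [set: E] ->
  propertyS E ->
  cstar_irreducible (tensor_sub (T := EA) B).
Proof.
move=> [subB irrB] simE _; split; first exact: tensor_sub_subalgebra.
(* The full algebra is itself intermediate between [B] and [A]. *)
have simA : cstar_simple [set: A].
  by apply: irrB => //; split=> //; split=> //; exact: closedT.
move=> D [D1 DD DZ DM [Ds Dclosed]] BD I [ID I0 Iadd Iscale [IM Iclosed]].
have [B1 _ _ _ _] := subB.
have tensD e b : B b -> D (tens EA e b).
  move=> Bb; apply: BD; apply: subset_closure; exists [:: (e, b)].
    by move=> p; rewrite inE => /eqP ->.
  by rewrite big_seq1.
have [I0'|] := pselect (I `<=` [set 0]).
  by left; apply/seteqP; split=> // _ ->.
move=> /existsNP[x /not_implyP[Ix /eqP x0]]; right.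
have [c c0 hc] := compress_limit simA simE x0.
(* Since [B] contains 1, the elements [e (x) 1] lie in [D]; compressions of [x] therefore stay in
   [I], and so does their limit. *)
have Ic : I (tens EA 1 c).
  move/closedR: Iclosed; apply=> eps /hc[s hs]; exists (compress s x) => //.
  rewrite /compress /conj_sum big_map; apply: big_ind => // e _.
  have De := tensD e _ B1.
  have [_ xe] := IM _ _ De Ix.
  by have [h _] := IM _ _ (Ds _ De) xe; rewrite -mulrA.
have [homD homZ homM homs hom1] := hom_tensr EA.
have closed_tens (F : set EA) : closed F -> closed [set a | F (tens EA 1 a)].
  move=> /closedR cF; apply/closedR => a ha; apply: cF => eps /ha[b Fb ab].
  by exists (tens EA 1 b); rewrite // -tensrB tensr_nr.
(* Irreducibility of [B] is applied to the pullback of [D] along [a |-> 1 (x) a], with the pullback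
   of [I] as closed ideal. *)
have [J0|JD] : [set a | I (tens EA 1 a)] = [set 0] \/
    [set a | I (tens EA 1 a)] = [set a | D (tens EA 1 a)].
- apply: (irrB [set a | D (tens EA 1 a)]) => [|b Bb|]; [|exact: tensD|].
    split=> /=.
    + by rewrite hom1.
    + by move=> a b Da Db; rewrite homD; exact: DD.
    + by move=> l a Da; rewrite homZ; exact: DZ.
    + by move=> a b Da Db; rewrite homM; exact: DM.
    + by split; [move=> a Da; rewrite homs; exact: Ds | exact: closed_tens].
  split=> /=.
  + by move=> a /ID.
  + by rewrite -(subrr (0 : A)) tensrB subrr.
  + by move=> a b Ia Ib; rewrite homD; exact: Iadd.
  + by move=> l a Ia; rewrite homZ; exact: Iscale.
  + split; last exact: closed_tens.
    by move=> d a Dd Ia; rewrite !homM; exact: IM.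
- have : [set a | I (tens EA 1 a)] c by [].
  by rewrite J0 /= => ce; rewrite ce eqxx in c0.
have I1 : I 1.
  have : [set a | D (tens EA 1 a)] 1 by rewrite /= hom1.
  by rewrite -JD /= hom1.
apply/seteqP; split=> // d Dd.
by have [+ _] := IM _ _ Dd I1; rewrite mulr1.
Qed.
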